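(* Let $X$ be a connected, locally finite, finite-dimensional simplicial complex equipped with an admissible weight $m$. Assume that $\mathrm{Lk}\,x$ is connected and $\mu_1(\mathrm{Lk}\,x)>\frac12$ for all $x\in X(0)$. Let $\Gamma$ be a finitely generated group acting by automorphisms, properly discontinuously and cofinitely on $X$. Let $Y$ be a Hadamard space all of whose tangent cones $TC_pY$ ($p\in Y$) are flexible, i.e. satisfy $\delta(TC_pY)=0$. Then for any homomorphism $\rho:\Gamma\to\mathrm{Isom}(Y)$, $\rho(\Gamma)$ has a fixed point in $Y$.
   Context: Simplicial complexes: $X(k)$ is the set of $k$-simplices of $X$, and $X(l)_s$ ($l>k$) is the set of $l$-simplices containing $s\in X(k)$. An admissible weight is a positive function $m:\bigcup_{k\ge0}X(k)\to\mathbb{R}$ with $m(s)=\sum_{t\in X(k+1)_s}m(t)$ for all $s\in X(k)$ with $X(k+1)_s\ne\emptyset$; it is also regarded as a symmetric function of ordered simplices. An automorphism of $X$ is a simplicial automorphism preserving $m$. The action of $\Gamma$ is properly discontinuous (in particular stabilizers of simplices are finite), and cofinite if $\Gamma$ has finitely many orbits in $X(k)$ for each $k$. The link $\mathrm{Lk}\,x$ is the subcomplex of simplices $t$ not containing $x$ such that $\{x\}\cup t$ is a simplex; $(\mathrm{Lk}\,x)(0)$ is its vertex set and $(\overrightarrow{\mathrm{Lk}\,x})(1)$ its set of ordered edges. $\mu_1(\mathrm{Lk}\,x)$ is the first nonzero eigenvalue of the Laplacian $(\Delta_{\mathrm{Lk}\,x}f)(y)=f(y)-\sum_{y':(y,y')\in(\overrightarrow{\mathrm{Lk}\,x})(1)}\frac{m(x,y,y')}{m(x,y)}f(y')$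 on functions $f:(\mathrm{Lk}\,x)(0)\to\mathbb{R}$; equivalently $$\mu_1(\mathrm{Lk}\,x)=\inf_f\frac{\frac12\sum_{(y,y')\in(\overrightarrow{\mathrm{Lk}\,x})(1)}m(x,y,y')|f(y)-f(y')|^2}{\sum_{y\in(\mathrm{Lk}\,x)(0)}m(x,y)|f(y)-\overline f|^2},\qquad \overline f=\sum_y\frac{m(x,y)}{m(x)}f(y),$$ over nonconstant $f$ (infimum over the empty set being $+\infty$). A Hadamard space is a complete CAT(0) space. For $p\in Y$, the tangent cone $TC_pY$ is the Euclidean cone over the space of directions $S_pY$ (completion of the set of nontrivial geodesics from $p$ modulo angle zero, with the angle metric): $d((V,t),(V',t'))^2=t^2+t'^2-2tt'\cos\angle_p(V,V')$. It is a Hadamard space. The barycenter of $v_1,\dots,v_n$ with weight $t_i\ge 0$, $\sum t_i=1$, is the unique minimizer of $q\mapsto\sum t_id(v_i,q)^2$. The invariant $\delta$: let $T$ be a Hadamard space, $v_1,\dots,v_n\in T$ distinct points ($n\ge2$), $t_i>0$ with $\sum t_i=1$, and $\overline v$ the barycenter of $\{v_i\}$ with weight $\{t_i\}$. A realization of $\{v_i\}$ is a collection of vectors $\mathbf v_1,\dots,\mathbf v_n\in\mathbb{R}^N$ for some $N$ with $\|\mathbf v_i\|=d_T(\overline v,v_i)$ and $\|\mathbf v_i-\mathbf v_j\|\le d_T(v_i,v_j)$. Put $\delta(\{v_i\},\{t_i\})=\inf\big[\|\sum_i t_i\mathbf v_i\|^2/\sum_i t_i\|\mathbf v_i\|^2\big]$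 over all realizations, and $\delta(T)=\sup\delta(\{v_i\},\{t_i\})\in[0,1]$ over all such collections (supremum over the empty set being $0$). $T$ is flexible if $\delta(T)=0$. *)

(* Defs.v *)
From HB Require Import structures.
From mathcomp Require Import all_boot all_order all_algebra finmap.
From mathcomp Require Import all_classical all_reals all_analysis.

Set Implicit Arguments.
Unset Strict Implicit.
Unset Printing Implicit Defensive.

Import Order.TTheory GRing.Theory Num.Theory.
Import numFieldNormedType.Exports.

Local Open Scope classical_set_scope.
Local Open Scope ring_scope.

(** * Weighted simplicial complexes *)

(* The vertex set [vertices X] may be a proper subset of V, so that the link of
   a vertex is again a complex over the same type V. *)
Record complex (V : choiceType) := Complex {
  simplices :> {fset V} -> Prop;
  simplices_neq0 : forall s, simplices s -> s != fset0;
  simplices_sub : forall s t,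
    simplices s -> (t `<=` s)%fset -> t != fset0 -> simplices t }.

Section Complexes.
Variables (R : realType) (V : choiceType).
Implicit Types (X : complex V) (m : {fset V} -> R) (x y : V) (s t : {fset V}).

Definition skeleton X (k : nat) : set {fset V} :=
  [set s | X s /\ #|` s| = k.+1].

Definition vertices X : set V := [set x | X [fset x]%fset].

Definition ordered_edge X x y : Prop := x != y /\ X [fset x; y]%fset.

(* The empty complex is connected for this definition; a link is empty only
   when its center is an isolated vertex. *)
Definition connected_complex X : Prop :=
  forall x y, vertices X x -> vertices X y ->
    exists2 p : seq V,
      path (fun u v => `[< ordered_edge X u v >]) x p & last x p = y.

Definition locally_finite X : Prop :=
  forall x, vertices X x -> finite_set [set s | X s /\ x \in s].

Definition finite_dimensional X : Prop :=
  exists d : nat, forall s, X s -> (#|` s| <= d.+1)%N.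

Definition cofaces X (k : nat) s : set {fset V} :=
  [set t | skeleton X k.+1 t /\ (s `<=` t)%fset].

(* Only the values of m on simplices of X matter. *)
Definition admissible_weight X m : Prop :=
  (forall s, X s -> 0 < m s) /\
  (forall k s, skeleton X k s -> cofaces X k s !=set0 ->
     m s = \sum_(t \in cofaces X k s) m t).

Definition link_set X x : set {fset V} :=
  [set t | [/\ t != fset0, x \notin t & X (x |` t)%fset]].

Lemma link_set_neq0 X x t : link_set X x t -> t != fset0.
Proof. by case. Qed.

Lemma link_set_sub X x s t :
  link_set X x s -> (t `<=` s)%fset -> t != fset0 -> link_set X x t.
Proof.
move=> [_ xs Xs] ts t0; split=> //.
  by apply: contra xs; exact: (fsubsetP ts).
apply: (simplices_sub Xs); first exact: fsetUS.
by apply/fset0Pn; exists x; rewrite fset1U1.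
Qed.

Definition link X x : complex V :=
  Complex (@link_set_neq0 X x) (@link_set_sub X x).

(* Functions on the vertices of the link are represented by functions on V, of
   which only the values on these vertices are used. *)
Definition link_laplacian X m x (f : V -> R) (y : V) : R :=
  f y - \sum_(y' \in [set y' | ordered_edge (link X x) y y'])
          m [fset x; y; y']%fset / m [fset x; y]%fset * f y'.

Definition link_eigenvalue X m x (l : R) : Prop :=
  exists f : V -> R,
    (exists2 y, vertices (link X x) y & f y != 0) /\
    (forall y, vertices (link X x) y -> link_laplacian X m x f y = l * f y).

(* First nonzero eigenvalue; +oo when there is none. *)
Definition mu1 X m x : \bar R :=
  ereal_inf [set l%:E | l in [set l : R | l != 0 /\ link_eigenvalue X m x l]].

Definition automorphism X m (phi : V -> V) : Prop :=
  [/\ set_bij (vertices X) (vertices X) phi,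
      forall s, (forall v, v \in s -> vertices X v) ->
        (X (phi @` s)%fset <-> X s)
    & forall s, X s -> m (phi @` s)%fset = m s].

End Complexes.

(** * Groups and their actions on complexes *)

Definition finitely_generated (G : groupType) : Prop :=
  exists2 S : set G, finite_set S &
    forall H : set G, H 1%g ->
      (forall g h, H g -> H h -> H (g * h)%g) ->
      (forall g, H g -> H g^-1%g) ->
      S `<=` H -> H = setT.

Section Actions.
Variables (R : realType) (V : choiceType) (G : groupType).
Variables (X : complex V) (m : {fset V} -> R) (act : G -> V -> V).

Definition acts_by_automorphisms : Prop :=
  [/\ forall x, vertices X x -> act 1%g x = x,
      forall g h x, vertices X x -> act (g * h)%g x = act g (act h x)
    & forall g, automorphism X m (act g)].

(* A compact subset of the geometric realization lies in a finite subcomplex K,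
   and g|K| meets |K| iff g maps some simplex of K to a simplex of K. *)
Definition properly_discontinuous : Prop :=
  forall K : set {fset V}, finite_set K -> K `<=` simplices X ->
    finite_set [set g : G | exists2 s, K s & K (act g @` s)%fset].

Definition orbit_of (s : {fset V}) : set {fset V} :=
  [set (act g @` s)%fset | g in [set: G]].

Definition cofinite_action : Prop :=
  forall k, finite_set [set orbit_of s | s in skeleton X k].

End Actions.

(** * Euclidean norm *)

(* The norm that the library puts on 'rV[R]_N is the sup norm. *)
Definition enorm (R : realType) (N : nat) (u : 'rV[R]_N) : R :=
  Num.sqrt (\sum_i u 0 i ^+ 2).

(** * Hadamard spaces and their isometries *)

Section Hadamard.
Variables (R : realType) (Y : metricType R).
Implicit Types (p q r x y : Y) (c : R -> Y).

(* c embeds [0, l] isometrically; its values elsewhere are irrelevant. *)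
Definition geodesic c (l : R) : Prop :=
  forall s t, 0 <= s <= l -> 0 <= t <= l -> mdist (c s) (c t) = `|s - t|.

Definition joins c p q : Prop :=
  [/\ c 0 = p, c (mdist p q) = q & geodesic c (mdist p q)].

(* Distances between points of a geodesic triangle are at most the Euclidean
   distances between their comparison points. It is enough to compare points on
   two sides, which meet at a vertex p since p, q, r are arbitrary. If p = q the
   only parameter on [p, q] is s = 0, with comparison point P. *)
Definition CAT0 : Prop :=
  (forall p q, exists c, joins c p q) /\
  (forall p q r c c', joins c p q -> joins c' p r ->
   forall P Q S : 'rV[R]_2,
     enorm (P - Q) = mdist p q -> enorm (P - S) = mdist p r ->
     enorm (Q - S) = mdist q r ->
   forall s t, 0 <= s <= mdist p q -> 0 <= t <= mdist p r ->
     mdist (c s) (c' t) <=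
     enorm ((P + (s / mdist p q) *: (Q - P)) -
            (P + (t / mdist p r) *: (S - P)))).

Definition complete_space : Prop :=
  forall F : set_system Y, ProperFilter F -> cauchy F ->
    exists y : Y, F --> y.

Definition hadamard : Prop := [/\ [set: Y] !=set0, complete_space & CAT0].

Record self_isometry := Isometry {
  isometry_fun :> Y -> Y;
  isometry_dist : forall x y,
    mdist (isometry_fun x) (isometry_fun y) = mdist x y;
  isometry_surj : forall y, exists x, isometry_fun x = y }.

HB.instance Definition _ := gen_eqMixin self_isometry.
HB.instance Definition _ := gen_choiceMixin self_isometry.

Lemma isometry_eq (f g : self_isometry) : f =1 g -> f = g.
Proof.
case: f g => f f1 f2 [g g1 g2] /= /funext fg.
by case: _ / fg in g1 g2 *; congr Isometry; exact: Prop_irrelevance.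
Qed.

Lemma isometry_inj (f : self_isometry) : injective f.
Proof.
move=> x y fxy; apply: mdist_positivity.
by rewrite -(isometry_dist f) fxy mdistxx.
Qed.

Definition isometry_id : self_isometry :=
  @Isometry id (fun _ _ => erefl) (fun y => ex_intro _ y erefl).

Lemma isometry_comp_dist (f g : self_isometry) x y :
  mdist (f (g x)) (f (g y)) = mdist x y.
Proof. by rewrite !isometry_dist. Qed.

Lemma isometry_comp_surj (f g : self_isometry) y : exists x, f (g x) = y.
Proof.
have [z <-] := isometry_surj f y; have [x <-] := isometry_surj g z.
by exists x.
Qed.

Definition isometry_comp (f g : self_isometry) : self_isometry :=
  Isometry (isometry_comp_dist f g) (isometry_comp_surj f g).

Definition isometry_inv_fun (f : self_isometry) y : Y :=
  projT1 (cid (isometry_surj f y)).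

Lemma isometry_invK (f : self_isometry) : cancel (isometry_inv_fun f) f.
Proof. by move=> y; rewrite /isometry_inv_fun; case: cid. Qed.

Lemma isometry_inv_dist (f : self_isometry) x y :
  mdist (isometry_inv_fun f x) (isometry_inv_fun f y) = mdist x y.
Proof. by rewrite -(isometry_dist f) !isometry_invK. Qed.

Lemma isometry_inv_surj (f : self_isometry) y :
  exists x, isometry_inv_fun f x = y.
Proof. by exists (f y); apply: (@isometry_inj f); rewrite isometry_invK. Qed.

Definition isometry_inv (f : self_isometry) : self_isometry :=
  Isometry (isometry_inv_dist f) (isometry_inv_surj f).

Lemma isometry_compA : associative isometry_comp.
Proof. by move=> f g h; exact: isometry_eq. Qed.

Lemma isometry_comp1 : left_id isometry_id isometry_comp.
Proof. by move=> f; exact: isometry_eq. Qed.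

Lemma isometry_comp1r : right_id isometry_id isometry_comp.
Proof. by move=> f; exact: isometry_eq. Qed.

Lemma isometry_compV : left_inverse isometry_id isometry_inv isometry_comp.
Proof.
move=> f; apply: isometry_eq => y /=.
by apply: (@isometry_inj f); rewrite isometry_invK.
Qed.

Lemma isometry_compVr : right_inverse isometry_id isometry_inv isometry_comp.
Proof. by move=> f; apply: isometry_eq => y /=; rewrite isometry_invK. Qed.

(* Isom(Y): the product f * g is the composite y |-> f (g y). *)
HB.instance Definition _ := isGroup.Build self_isometry
  isometry_compA isometry_comp1 isometry_comp1r isometry_compV isometry_compVr.

End Hadamard.

(** * Tangent cones *)

Section TangentCone.
Variables (R : realType) (Y : metricType R) (p : Y).

Record geodesic_from := GeodesicFrom {
  geodesic_length : R;
  geodesic_path :> R -> Y;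
  geodesic_length_gt0 : 0 < geodesic_length;
  geodesic_start : geodesic_path 0 = p;
  geodesic_isometric : geodesic geodesic_path geodesic_length }.

Definition comparison_angle (x y : Y) : R :=
  acos ((mdist p x ^+ 2 + mdist p y ^+ 2 - mdist x y ^+ 2) /
        (2 * mdist p x * mdist p y)).

(* The limit exists when Y is CAT(0). *)
Definition angle (c c' : geodesic_from) : R :=
  lim (comparison_angle (c st.1) (c' st.2)
        @[st --> filter_prod (0 : R)^'+ (0 : R)^'+]).

(* The completion of the space of geodesics modulo zero angle, as Cauchy
   sequences with the limit distance. No quotient is taken: a point of the space
   of directions is a class for [direction_angle V W = 0]. *)
Record direction := Direction {
  direction_seq :> nat -> geodesic_from;
  direction_cauchy : forall e : R, 0 < e ->
    exists n0 : nat, forall n k, (n0 <= n)%N -> (n0 <= k)%N ->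
      angle (direction_seq n) (direction_seq k) < e }.

Definition direction_angle (v w : direction) : R :=
  lim (angle (v n) (w n) @[n --> \oo]).

(* Likewise a point of the tangent cone is a class for [cone_dist a b = 0]; this
   identifies all the pairs (V, 0) with the apex. *)
Definition tangent_cone : Type := (direction * {nonneg R})%type.

Definition cone_dist (a b : tangent_cone) : R :=
  let s := a.2%:num in let t := b.2%:num in
  Num.sqrt (s ^+ 2 + t ^+ 2 - 2 * s * t * cos (direction_angle a.1 b.1)).

End TangentCone.

(** * The invariant delta *)

(* T is given with a distance d that may vanish on distinct elements of T, the
   space meant being the quotient of T by d x y = 0; hence points are distinct
   when their distance is nonzero. *)
Section Delta.
Variables (R : realType) (T : Type) (d : T -> T -> R).

Section Collection.
Variables (n : nat) (v : 'I_n -> T) (t : 'I_n -> R).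

Definition barycenter (b : T) : Prop :=
  forall q, \sum_i t i * d (v i) b ^+ 2 <= \sum_i t i * d (v i) q ^+ 2.

Definition realization (b : T) (N : nat) (w : 'I_n -> 'rV[R]_N) : Prop :=
  (forall i, enorm (w i) = d b (v i)) /\
  (forall i j, enorm (w i - w j) <= d (v i) (v j)).

Definition delta_of (b : T) : R :=
  inf [set r : R | exists N, exists2 w : 'I_n -> 'rV[R]_N,
    realization b w &
    r = enorm (\sum_i t i *: w i) ^+ 2 / \sum_i t i * enorm (w i) ^+ 2].

End Collection.

(* Here [sup set0 = 0]. *)
Definition delta : R :=
  sup [set r : R | exists (n : nat) (v : 'I_n -> T) (t : 'I_n -> R) (b : T),
    [/\ (2 <= n)%N,
        forall i j, i != j -> d (v i) (v j) != 0,
        (forall i, 0 < t i) /\ \sum_i t i = 1,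
        barycenter v t b
      & r = delta_of v t b]].

Definition flexible : Prop := delta = 0.

End Delta.

(* Main.v *)
Require Import Defs.
From HB Require Import structures.
From mathcomp Require Import all_boot all_order all_algebra finmap.
From mathcomp Require Import all_classical all_reals all_analysis.
From mathcomp Require Import ring lra.

Set Implicit Arguments.
Unset Strict Implicit.
Unset Printing Implicit Defensive.

Import Order.TTheory GRing.Theory Num.Theory.
Import numFieldNormedType.Exports.

Local Open Scope classical_set_scope.
Local Open Scope ring_scope.

(** The proof is Garland's method, run as a discrete flow on the equivariant maps
    from the vertices of [X] to [Y].

    The local part is a Poincare inequality for maps from a link to [Y]. Let [b]
    be the barycenter of weighted points [v i] of [Y]. By the first variation
    of the distance, the images of the [v i] in the tangent cone at [b] have the
    apex as barycenter; their distances to the apex are the [d b (v i)], and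
    their mutual distances are at most the [d (v i) (v j)]. As the tangent cone
    is flexible, there are vectors [u i] with these norms, with mutual distances
    at most [d (v i) (v j)], and with weighted sum as small as desired
    ([barycenter_realization]). The Poincare inequality of the link, whose
    constant is its first nonzero eigenvalue, holds for each coordinate of these
    vectors, hence for maps to [Y] with the same constant
    ([link_poincare_hadamard]).

    For the global part, the energy [energy f h] of two equivariant maps is the
    sum over the oriented edges [(x, y)] modulo the group of the weighted squared
    distances from [f x] to [h y]; it is symmetric by mass transport
    ([orbit_sum_sym]). Let [f'] map each vertex to the barycenter of the values
    of [f] at its neighbors. Summing the Poincare inequalities over the vertices
    and using that the weights of the triangles around an edge add up to at most
    the weight of the edge gives [2 * mu * energy f' f <= energy f f]
    ([energy_average]), where [2 * mu > 1] can be chosen uniformly since there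
    are finitely many orbits of vertices. By convexity of the distance, moving
    [f] a little towards [f'] then decreases the energy by a factor less than
    one, while the displacements are bounded by the energy ([flow_step]). So
    the iterates converge geometrically at each vertex, and the distances of
    their values at adjacent vertices tend to zero. As [X] is connected, the
    limits at [x] and at [act g x] agree for every [g]; by equivariance the
    limit is a fixed point. *)

(** * Euclidean vectors *)

Section EuclideanNorm.
Variable R : realType.

Lemma enorm_sqr N (u : 'rV[R]_N) : enorm u ^+ 2 = \sum_i u 0 i ^+ 2.
Proof. by rewrite sqr_sqrtr// sumr_ge0// => i _; rewrite sqr_ge0. Qed.

Lemma enormZ N (a : R) (u : 'rV[R]_N) :
  enorm (a *: u) ^+ 2 = a ^+ 2 * enorm u ^+ 2.
Proof.
by rewrite !enorm_sqr mulr_sumr; apply: eq_bigr => i _; rewrite mxE exprMn.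
Qed.

Lemma enorm_row2 (x y : R) (u : 'rV[R]_2) :
  u = (\row_(i < 2) (if i == ord0 then x else y)) ->
  enorm u = Num.sqrt (x ^+ 2 + y ^+ 2).
Proof.
by move=> ->; rewrite /enorm !big_ord_recl big_ord0 addr0 !mxE.
Qed.

End EuclideanNorm.

Section Dot.
Variable R : realType.

Definition dot N (u v : 'rV[R]_N) : R := \sum_i u 0 i * v 0 i.

Lemma enorm_lin_sub N (a b : R) (u v : 'rV[R]_N) :
  enorm (a *: u - b *: v) ^+ 2 =
  a ^+ 2 * enorm u ^+ 2 + b ^+ 2 * enorm v ^+ 2 - 2 * a * b * dot u v.
Proof.
rewrite !enorm_sqr !mulr_sumr -big_split -sumrB /=; apply: eq_bigr => i _.
by rewrite !mxE; ring.
Qed.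

Lemma dotZ N (a b : R) (u v : 'rV[R]_N) : dot (a *: u) (b *: v) = a * b * dot u v.
Proof. by rewrite /dot mulr_sumr; apply: eq_bigr => i _; rewrite !mxE; ring. Qed.

(** Jensen's inequality, in every coordinate. *)
Lemma enorm_sum_le N n (t : 'I_n -> R) (w : 'I_n -> 'rV[R]_N) :
  (forall i, 0 < t i) -> \sum_i t i = 1 ->
  enorm (\sum_i t i *: w i) ^+ 2 <= \sum_i t i * enorm (w i) ^+ 2.
Proof.
move=> t0 t1; rewrite enorm_sqr.
have -> : \sum_i t i * enorm (w i) ^+ 2 = \sum_j \sum_i t i * w i 0 j ^+ 2.
  rewrite exchange_big /=; apply: eq_bigr => i _.
  by rewrite enorm_sqr mulr_sumr.
apply: ler_sum => j _; rewrite summxE.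
have -> : \sum_i (t i *: w i) 0 j = \sum_i t i * w i 0 j.
  by apply: eq_bigr => i _; rewrite mxE.
set m := \sum_i _.
have : 0 <= \sum_i t i * (w i 0 j - m) ^+ 2.
  by apply: sumr_ge0 => i _; rewrite mulr_ge0 ?sqr_ge0// ltW.
have -> (x : R) : \sum_i t i * (w i 0 j - x) ^+ 2 =
    \sum_i t i * w i 0 j ^+ 2 - 2 * x * (\sum_i t i * w i 0 j) +
    x ^+ 2 * \sum_i t i.
  rewrite !mulr_sumr -sumrB -big_split /=; apply: eq_bigr => i _; ring.
by rewrite t1 -/m; lra.
Qed.

End Dot.

(** * Comparison in CAT(0) spaces *)

Section CAT0Comparison.
Variables (R : realType) (Y : metricType R).
Implicit Types (p q r x y z : Y) (c : R -> Y).
Local Notation d := mdist.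

Lemma mdist_lerB x y z : d x y - d y z <= d x z.
Proof. by rewrite lerBlDr [d y z]metric_sym; exact: metric_triangle. Qed.

(** The comparison triangle is placed with its apex at the origin and its first
    side on the first axis; the law of cosines then reads off the bound. *)
Lemma CAT0_law_of_cosines p q r c c' s t : CAT0 Y ->
  joins c p q -> joins c' p r -> 0 < d p q -> 0 < d p r ->
  0 <= s <= d p q -> 0 <= t <= d p r ->
  d (c s) (c' t) ^+ 2 <= s ^+ 2 + t ^+ 2 -
    s * t * ((d p q ^+ 2 + d p r ^+ 2 - d q r ^+ 2) / (d p q * d p r)).
Proof.
move=> [_ cat] cj c'j.
set a := d p q; set b := d p r; set e := d q r => a0 b0 sa tb.
have e0 : 0 <= e by exact: mdist_ge0.
have tri1 : e <= a + b.
  by rewrite /a [d p q]metric_sym; exact: metric_triangle.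
have tri2 : a <= b + e.
  by rewrite /e [d q r]metric_sym; exact: metric_triangle.
have tri3 : b <= a + e by exact: metric_triangle.
pose x := (a ^+ 2 + b ^+ 2 - e ^+ 2) / (2 * a).
have xE : 2 * a * x = a ^+ 2 + b ^+ 2 - e ^+ 2 by rewrite /x; field; lra.
have xb : x ^+ 2 <= b ^+ 2.
  have : - b <= x <= b.
    by apply/andP; split; rewrite -(ler_pM2l (_ : 0 < 2 * a)) ?xE; nra.
  by move=> ?; nra.
pose y := Num.sqrt (b ^+ 2 - x ^+ 2).
have yE : y ^+ 2 = b ^+ 2 - x ^+ 2 by rewrite sqr_sqrtr// subr_ge0.
pose vec (u v : R) : 'rV[R]_2 := \row_(i < 2) (if i == ord0 then u else v).
have vecB u v u' v' : vec u v - vec u' v' = vec (u - u') (v - v').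
  by apply/rowP => i; rewrite !mxE; case: ifP.
have H0 : enorm (vec 0 0 - vec a 0) = a.
  rewrite vecB (enorm_row2 erefl) !sub0r sqrrN oppr0 expr0n addr0.
  by rewrite sqrtr_sqr ger0_norm// ltW.
have H1 : enorm (vec 0 0 - vec x y) = b.
  rewrite vecB (enorm_row2 erefl) !sub0r !sqrrN yE addrC subrK.
  by rewrite sqrtr_sqr ger0_norm// ltW.
have H2 : enorm (vec a 0 - vec x y) = e.
  rewrite vecB (enorm_row2 erefl) sub0r sqrrN yE.
  have -> : (a - x) ^+ 2 + (b ^+ 2 - x ^+ 2) = e ^+ 2.
    by rewrite -[RHS]opprK -[e ^+ 2](subKr (a ^+ 2 + b ^+ 2)) -xE; ring.
  by rewrite sqrtr_sqr ger0_norm.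
have := cat _ _ _ _ _ cj c'j _ _ _ H0 H1 H2 _ _ sa tb.
have -> : vec 0 0 + (s / a) *: (vec a 0 - vec 0 0) -
          (vec 0 0 + (t / b) *: (vec x y - vec 0 0)) =
          vec (s - t / b * x) (- (t / b * y)).
  by apply/rowP => i; rewrite !mxE; case: ifP => _; field; apply/andP; split; lra.
rewrite (enorm_row2 erefl) => le.
have {le} : d (c s) (c' t) ^+ 2 <= (s - t / b * x) ^+ 2 + (- (t / b * y)) ^+ 2.
  rewrite -[leRHS]sqr_sqrtr ?addr_ge0 ?sqr_ge0//.
  by rewrite ler_sqr// nnegrE ?mdist_ge0 ?sqrtr_ge0.
move=> /le_trans; apply; rewrite sqrrN sqrrB !exprMn yE.
have -> : e ^+ 2 = a ^+ 2 + b ^+ 2 - 2 * a * x by rewrite xE; ring.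
rewrite le_eqVlt; apply/orP; left; apply/eqP; field.
by apply/andP; split; lra.
Qed.

(** In a CAT(0) space this inequality characterizes the point [z] that divides
    the geodesic from [p] to [q] in the ratio [l : 1 - l], so that points of
    geodesics can be handled without their parametrizations. *)
Definition divides (l : R) p q z : Prop := forall r,
  d r z ^+ 2 <= (1 - l) * d r p ^+ 2 + l * d r q ^+ 2
                - l * (1 - l) * d p q ^+ 2.

Lemma CAT0_divides (l : R) p q : CAT0 Y -> 0 <= l <= 1 -> exists z, divides l p q z.
Proof.
move=> cat /andP[l0 l1]; have [c cj] := cat.1 p q.
have [c0 c1 cg] := cj; have [pq|pq] := eqVneq (d p q) 0.
  exists p => r; rewrite -(mdist_positivity _ _ pq) mdistxx; lra.
have a0 : 0 < d p q by rewrite lt_def mdist_ge0 andbT.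
exists (c (l * d p q)) => r; rewrite [d r (c _)]metric_sym.
have la : 0 <= l * d p q <= d p q by nra.
have [rp|rp] := eqVneq (d p r) 0.
  rewrite -(mdist_positivity _ _ rp) mdistxx [d _ p]metric_sym.
  rewrite -{1}c0 cg ?lexx ?mdist_ge0//.
  by rewrite sub0r normrN ger0_norm; nra.
have b0 : 0 < d p r by rewrite lt_def mdist_ge0 andbT.
have [c' c'j] := cat.1 p r; have [_ c'r _] := c'j.
have := CAT0_law_of_cosines cat cj c'j a0 b0 la (_ : 0 <= d p r <= d p r).
rewrite c'r lexx mdist_ge0 => /(_ isT) /le_trans; apply.
rewrite [d r p]metric_sym [d r q]metric_sym.
rewrite le_eqVlt; apply/orP; left; apply/eqP; field.
by apply/andP; split; lra.
Qed.

(** Each of the two points is tested in the inequality of the other. *)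
Lemma divides_uniq (l : R) p q z z' : 0 <= l <= 1 ->
  divides l p q z -> divides l p q z' -> z = z'.
Proof.
move=> /andP[l0 l1] dz dz'; apply/esym/mdist_positivity.
have := dz z'; have := dz' p; have := dz' q.
rewrite !mdistxx [d q p]metric_sym [d q z']metric_sym [d p z']metric_sym.
set D := d p q; set u := d z' p; set v := d z' q => hv hu h.
have : d z' z ^+ 2 <= 0.
  have l1' : 0 <= 1 - l by lra.
  have := ler_wpM2l l0 hv; have := ler_wpM2l l1' hu; nra.
by move=> h0; apply/eqP; rewrite -sqrf_eq0 eq_le h0 sqr_ge0.
Qed.

Lemma dist_divides (l : R) p q z : 0 <= l <= 1 -> divides l p q z ->
  d p z ^+ 2 <= l ^+ 2 * d p q ^+ 2.
Proof. by move=> l01 /(_ p); rewrite mdistxx; nra. Qed.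

(** The inequality for the second segment is applied at [z], and its right-hand
    side is then estimated with the inequality for the first segment. *)
Lemma divides_quadrilateral (l : R) p q p' q' z w : 0 <= l <= 1 ->
  divides l p q z -> divides l p' q' w ->
  d z w ^+ 2 <= (1 - l) ^+ 2 * d p p' ^+ 2
     + l * (1 - l) * (d p q' ^+ 2 + d q p' ^+ 2) + l ^+ 2 * d q q' ^+ 2.
Proof.
move=> /andP[l0 l1] dz dw; have h := dw z.
have hp : d z p' ^+ 2 <= (1 - l) * d p p' ^+ 2 + l * d q p' ^+ 2
                         - l * (1 - l) * d p q ^+ 2.
  by have := dz p'; rewrite ![d p' _]metric_sym.
have hq : d z q' ^+ 2 <= (1 - l) * d p q' ^+ 2 + l * d q q' ^+ 2
                         - l * (1 - l) * d p q ^+ 2.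
  by have := dz q'; rewrite ![d q' _]metric_sym.
have l1' : 0 <= 1 - l by lra.
have := ler_wpM2l l0 hq; have := ler_wpM2l l1' hp => h1 h2.
have D3 : 0 <= l * (1 - l) * d p q ^+ 2 by rewrite mulr_ge0 ?sqr_ge0// mulr_ge0.
have D4 : 0 <= l * (1 - l) * d p' q' ^+ 2 by rewrite mulr_ge0 ?sqr_ge0// mulr_ge0.
lra.
Qed.

End CAT0Comparison.

(** * Barycenters *)

Section Minimizers.
Variables (R : realType) (Y : metricType R).
Implicit Types (p q r z : Y) (F : Y -> R).
Local Notation d := mdist.

Definition strongly_convex F (k : R) : Prop := forall p q z,
  divides 2^-1 p q z -> F z <= (F p + F q) / 2 - k * d p q ^+ 2 / 4.

Definition lower_semicontinuous_at F q : Prop := forall e, 0 < e ->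
  exists2 h, 0 < h & forall q', d q q' < h -> F q <= F q' + e.

Let half01 : 0 <= (2^-1 : R) <= 1.
Proof. by lra. Qed.

Lemma strongly_convex_min_uniq F k z z' : CAT0 Y -> 0 < k ->
  strongly_convex F k -> (forall q, F z <= F q) -> (forall q, F z' <= F q) ->
  z = z'.
Proof.
move=> cat k0 sc Fz Fz'; have [w zw] := CAT0_divides z z' cat half01.
have := sc _ _ _ zw; have := Fz w; have := Fz' w => h1 h2 h3.
apply/mdist_positivity/eqP; rewrite -sqrf_eq0 eq_le sqr_ge0 andbT.
by rewrite -(pmulr_rle0 _ k0); lra.
Qed.

(** The sublevel sets just above the infimum have small diameter, so they
    generate a Cauchy filter, and its limit is the minimizer. *)
Lemma strongly_convex_min F k : hadamard Y -> 0 < k ->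
  strongly_convex F k -> (forall q, 0 <= F q) ->
  (forall q, lower_semicontinuous_at F q) -> exists z, forall q, F z <= F q.
Proof.
move=> [[y0 _] compl cat] k0 sc F0 lsc.
pose m := inf (range F).
have hi : has_inf (range F).
  by split; [exists (F y0), y0 | exists 0 => _ [q _ <-]].
have mF q : m <= F q by apply: ge_inf; [exact: hi.2 | exists q].
have ex e : 0 < e -> exists q, F q <= m + e.
  by move=> e0; have [_ [q _ <-] /ltW] := inf_adherent e0 hi; exists q.
pose base (e : R) : set Y := [set q | F q <= m + e].
pose FF := filter_from [set e : R | 0 < e] base.
have FFF : ProperFilter FF.
  apply: filter_from_proper; last by move=> e /ex[q Fq]; exists q.
  apply: filter_from_filter; first by exists 1 => /=.
  move=> e1 e2 /= e10 e20; exists (Num.min e1 e2) => /=.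
    by rewrite lt_min e10.
  move=> q; rewrite /base /= => Fq; split; apply: (le_trans Fq).
    by rewrite lerD2l ge_min lexx.
  by rewrite lerD2l ge_min lexx orbT.
have diam e p q : 0 < e -> base e p -> base e q -> k * d p q ^+ 2 <= 4 * e.
  move=> e0; rewrite /base /= => Fp Fq.
  have [w pw] := CAT0_divides p q cat half01.
  by have := sc _ _ _ pw; have := mF w; lra.
have : cauchy FF.
  apply/cauchyP => e e0.
  have e'0 : 0 < k * e ^+ 2 / 8 by rewrite divr_gt0// mulr_gt0// exprn_gt0.
  have [x Fx] := ex _ e'0; exists x, (k * e ^+ 2 / 8) => //= q Fq.
  have := diam _ _ _ e'0 Fx Fq => h.
  rewrite ballEmdist /=.
  rewrite -(ltr_pXn2r (_ : 0 < 2)%N) ?nnegrE ?mdist_ge0// 1?ltW//.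
  rewrite -(ltr_pM2l k0); apply: (le_lt_trans h).
  have : 0 < k * e ^+ 2 by rewrite mulr_gt0// exprn_gt0.
  by lra.
move=> /(compl _ FFF)[z FFz]; exists z => q; apply: le_trans (mF q).
apply/ler_addgt0Pr => e e0; have e20 : 0 < e / 2 by rewrite divr_gt0.
have [h h0 lscz] := lsc z _ e20.
have : nbhs z (ball z h) by exact: nbhsx_ballx.
move=> /FFz [e1 /= e10 sub].
have m0 : 0 < Num.min e1 (e / 2) by rewrite lt_min e10.
have [x Fx] := ex _ m0.
have : base e1 x by apply: (le_trans Fx); rewrite lerD2l ge_min lexx.
move=> /sub; rewrite ballEmdist /= => /lscz.
have : F x <= m + e / 2.
  by apply: (le_trans Fx); rewrite lerD2l ge_min lexx orbT.
by lra.
Qed.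

End Minimizers.

Section Barycenters.
Variables (R : realType) (Y : metricType R) (I : eqType).
Variables (s : seq I) (t : I -> R) (v : I -> Y).
Hypotheses (t_ge0 : forall i, i \in s -> 0 <= t i).
Local Notation d := mdist.

Definition dispersion (q : Y) : R := \sum_(i <- s) t i * d (v i) q ^+ 2.

Lemma dispersion_strongly_convex :
  strongly_convex dispersion (\sum_(i <- s) t i).
Proof.
move=> p q z zm.
have -> : (dispersion p + dispersion q) / 2
          - (\sum_(i <- s) t i) * d p q ^+ 2 / 4 =
    \sum_(i <- s) t i * ((d (v i) p ^+ 2 + d (v i) q ^+ 2) / 2 - d p q ^+ 2 / 4).
  rewrite /dispersion -big_split /= -mulrA !mulr_suml -sumrB.
  by apply: eq_bigr => i _; ring.
rewrite /dispersion big_seq_cond [leRHS]big_seq_cond.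
apply: ler_sum => i; rewrite andbT => /t_ge0 ti.
have := ler_wpM2l ti (zm (v i)); lra.
Qed.

Lemma dispersion_lsc q : lower_semicontinuous_at dispersion q.
Proof.
move=> e e0; pose M := \sum_(i <- s) t i * d (v i) q.
have M0 : 0 <= M.
  by rewrite /M big_seq sumr_ge0// => i /t_ge0 ti; rewrite mulr_ge0// mdist_ge0.
have M1 : 0 < 1 + 2 * M by lra.
exists (e / (1 + 2 * M)); first by rewrite divr_gt0.
move=> q' qq'; set h := d q q' in qq'.
have h0 : 0 <= h by exact: mdist_ge0.
have : dispersion q <= dispersion q' + 2 * h * M.
  rewrite /dispersion /M mulr_sumr -big_split /= !big_seq.
  apply: ler_sum => i /t_ge0 ti.
  have : d (v i) q <= d (v i) q' + h.
    by rewrite /h [d q q']metric_sym; exact: metric_triangle.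
  have := mdist_ge0 (v i) q; have := mdist_ge0 (v i) q' => h1 h2 h3.
  have : d (v i) q ^+ 2 <= d (v i) q' ^+ 2 + 2 * h * d (v i) q.
    by case: (lerP (d (v i) q) (d (v i) q')) => ?; nra.
  by move=> /(ler_wpM2l ti); lra.
move=> /le_trans; apply; rewrite lerD2l.
have : h * (1 + 2 * M) <= e by rewrite -ler_pdivlMr// ltW.
by nra.
Qed.

Lemma dispersion_min : hadamard Y -> 0 < \sum_(i <- s) t i ->
  exists b, forall q, dispersion b <= dispersion q.
Proof.
move=> had t0; apply: (strongly_convex_min had t0 dispersion_strongly_convex).
  move=> q; rewrite /dispersion big_seq sumr_ge0// => i /t_ge0 ti.
  by rewrite mulr_ge0// sqr_ge0.
exact: dispersion_lsc.
Qed.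

Lemma dispersion_min_uniq b b' : CAT0 Y -> 0 < \sum_(i <- s) t i ->
  (forall q, dispersion b <= dispersion q) ->
  (forall q, dispersion b' <= dispersion q) -> b = b'.
Proof.
by move=> cat t0; apply: (strongly_convex_min_uniq cat t0 dispersion_strongly_convex).
Qed.

End Barycenters.

(** * Angles and directions *)

Section Angles.
Variables (R : realType) (Y : metricType R) (p : Y).
Hypothesis cat : CAT0 Y.
Implicit Types (c : geodesic_from p) (W : direction p).
Local Notation d := mdist.
Local Notation len := geodesic_length.

Lemma geodesic_dist c (s t : R) : 0 <= s <= len c -> 0 <= t <= len c ->
  d (c s) (c t) = `|s - t|.
Proof. by move=> ? ?; exact: geodesic_isometric. Qed.

Lemma geodesic_dist0 c (s : R) : 0 <= s <= len c -> d p (c s) = s.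
Proof.
move=> /andP[s0 sl]; rewrite -{1}(geodesic_start c) geodesic_dist ?s0 ?lexx//.
  by rewrite sub0r normrN ger0_norm.
exact: ltW (geodesic_length_gt0 c).
Qed.

Lemma geodesic_joins c (s : R) : 0 <= s <= len c -> joins c p (c s).
Proof.
move=> /andP[s0 sl]; split; first exact: geodesic_start.
  by rewrite geodesic_dist0// s0.
rewrite geodesic_dist0 ?s0// => a b /andP[a0 a1] /andP[b0 b1].
by rewrite geodesic_dist// ?a0 ?b0/= ?(le_trans a1)// ?(le_trans b1).
Qed.

(** The cosine of the comparison angle at [p] of [p], [c s], [c' t]. *)
Definition comparison_cos c c' (s t : R) : R :=
  (s ^+ 2 + t ^+ 2 - d (c s) (c' t) ^+ 2) / (2 * s * t).

Lemma comparison_cosE c c' (s t : R) : 0 < s -> 0 < t ->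
  d (c s) (c' t) ^+ 2 = s ^+ 2 + t ^+ 2 - 2 * s * t * comparison_cos c c' s t.
Proof. by move=> s0 t0; rewrite /comparison_cos; field; apply/andP; split; lra. Qed.

Lemma comparison_cos_itv c c' (s t : R) : 0 < s <= len c -> 0 < t <= len c' ->
  -1 <= comparison_cos c c' s t <= 1.
Proof.
move=> /andP[s0 sl] /andP[t0 tl].
have h1 := @geodesic_dist0 c s; rewrite sl ltW// in h1.
have h2 := @geodesic_dist0 c' t; rewrite tl ltW// in h2.
have := mdist_lerB (c s) p (c' t); have := mdist_lerB (c' t) p (c s).
have := metric_triangle (c s) p (c' t).
rewrite ![d (c s) p]metric_sym ![d (c' t) p]metric_sym [d (c' t) _]metric_sym.
rewrite h1// h2//; set D := d _ _ => u1 u2 u3.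
have D0 : 0 <= D by exact: mdist_ge0.
have st0 : 0 < 2 * s * t by rewrite !mulr_gt0.
rewrite /comparison_cos -/D ler_pdivlMr// ler_pdivrMr//.
by apply/andP; split; nra.
Qed.

(** The law of cosines, with the larger triangle as comparison triangle. *)
Lemma comparison_cos_anti c c' (s s' t t' : R) :
  0 < s <= s' -> s' <= len c -> 0 < t <= t' -> t' <= len c' ->
  comparison_cos c c' s' t' <= comparison_cos c c' s t.
Proof.
move=> /andP[s0 ss'] s'l /andP[t0 tt'] t'l.
have s'0 := lt_le_trans s0 ss'; have t'0 := lt_le_trans t0 tt'.
have s'i : 0 <= s' <= len c by rewrite s'l ltW.
have t'i : 0 <= t' <= len c' by rewrite t'l ltW.
have := CAT0_law_of_cosines (s := s) (t := t) cat (geodesic_joins s'i)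
  (geodesic_joins t'i).
rewrite !geodesic_dist0// (comparison_cosE c c' s0 t0) (comparison_cosE c c' s'0 t'0).
move=> /(_ s'0 t'0); rewrite ss' tt' (ltW s0) (ltW t0) => /(_ isT isT).
set X := comparison_cos _ _ _ _; set Z := comparison_cos _ _ _ _.
have -> : (s' ^+ 2 + t' ^+ 2 - (s' ^+ 2 + t' ^+ 2 - 2 * s' * t' * Z)) /
  (s' * t') = 2 * Z by field; apply/andP; split; lra.
by move=> le; rewrite -(ler_pM2l (_ : 0 < 2 * s * t)) ?mulr_gt0//; lra.
Qed.

Lemma acos_within : {within `[-1, 1], continuous (@acos R)}.
Proof.
rewrite -(cospi R) -(cos0 R); apply: segment_can_ge_continuous.
- exact: pi_ge0.
- by apply: continuous_subspaceT; exact: continuous_cos.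
- exact: cosK.
Qed.

(** Comparison cosines may converge to 1 or -1, so that continuity is needed on
    the closed interval. *)
Lemma cvg_acos (T : Type) (F : set_system T) (f : T -> R) (l : R)
    {FF : ProperFilter F} :
  (\forall x \near F, -1 <= f x <= 1) -> f @ F --> l -> acos \o f @ F --> acos l.
Proof.
move=> nf fl.
have l1 : -1 <= l <= 1.
  apply/andP; split.
    by apply: (cvgr_to_ge fl); apply: filterS nf => x /andP[].
  by apply: (cvgr_to_le fl); apply: filterS nf => x /andP[].
have := (subspace_continuousP _ _).1 acos_within l.
rewrite /= in_itv /= l1 => /(_ isT) cl.
apply: (cvg_comp _ _ _ cl); move=> A /= [e e0 Ae].
have := fl _ (nbhsx_ballx l e e0); rewrite /nbhs /= => fle.
by apply: filterS2 nf fle => x x1 fx; apply: Ae => //=.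
Qed.

Lemma comparison_cos_sup c c' : exists2 q : R,
  (forall s t : R, 0 < s <= len c -> 0 < t <= len c' ->
     comparison_cos c c' s t <= q)
  & (forall e : R, 0 < e -> exists2 h : R, 0 < h <= len c /\ h <= len c' &
     forall s t : R, 0 < s <= h -> 0 < t <= h ->
     q - e < comparison_cos c c' s t).
Proof.
pose A : set R := [set r | exists s t, [/\ 0 < s <= len c, 0 < t <= len c' &
  r = comparison_cos c c' s t]].
have supA : has_sup A.
  split.
    exists (comparison_cos c c' (len c) (len c')), (len c), (len c').
    by rewrite !lexx !geodesic_length_gt0.
  exists 1 => _ [s [t [si ti ->]]].
  by have /andP[] := comparison_cos_itv si ti.
exists (sup A) => [s t si ti|e e0].
  by apply: ub_le_sup; [exact: supA.2 | exists s, t].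
have [_ [s [t [/andP[s0 sl] /andP[t0 tl] ->]]] lt] := sup_adherent e0 supA.
have h0 : 0 < Num.min s t by rewrite lt_min s0.
exists (Num.min s t).
  rewrite h0; split=> /=; first by apply: le_trans sl; rewrite ge_min lexx.
  by apply: le_trans tl; rewrite ge_min lexx orbT.
move=> s' t' /andP[s'0 s'h] /andP[t'0 t'h]; apply: (lt_le_trans lt).
apply: comparison_cos_anti; rewrite ?s'0 ?t'0//=.
  by apply: le_trans s'h _; rewrite ge_min lexx.
by apply: le_trans t'h _; rewrite ge_min lexx orbT.
Qed.

(** Comparison cosines increase as the two points approach [p] and are at most
    one, so the limit in the definition of the angle exists. *)
Lemma angleP c c' : exists q : R, [/\ -1 <= q <= 1, angle c c' = acos q,
  (forall s t : R, 0 < s <= len c -> 0 < t <= len c' ->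
     comparison_cos c c' s t <= q)
  & (forall e : R, 0 < e -> exists2 h : R, 0 < h <= len c /\ h <= len c' &
     forall s t : R, 0 < s <= h -> 0 < t <= h ->
     q - e < comparison_cos c c' s t)].
Proof.
have [q ub approx] := comparison_cos_sup c c'; exists q.
have near0 (h : R) (P : set (R * R)) : 0 < h ->
    (forall s t, 0 < s <= h -> 0 < t <= h -> P (s, t)) ->
    filter_prod (0 : R)^'+ (0 : R)^'+ P.
  move=> h0 Ph; have nh : \forall s \near (0 : R)^'+, 0 < s <= h.
    near=> s; apply/andP; split; near: s; first exact: nbhs_right_gt.
    exact: nbhs_right_ltW.
  exists ([set s | 0 < s <= h], [set s | 0 < s <= h]) => //=.
  by case=> s t /= [si ti]; apply: Ph.
have cvq : comparison_cos c c' st.1 st.2 @[st --> filter_prod (0 : R)^'+ (0 : R)^'+]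
    --> q.
  apply/cvgrPdist_lt => e e0; have [h [/andP[h0 hl] hl'] Ph] := approx _ e0.
  apply: (near0 _ _ h0) => s t si ti /=.
  have lt := Ph _ _ si ti; have le : comparison_cos c c' s t <= q.
    case/andP: si => s0 sh; case/andP: ti => t0 th.
    by apply: ub; rewrite ?s0 ?t0 /= ?(le_trans sh)// (le_trans th).
  by rewrite ger0_norm ?subr_ge0//; lra.
have [h [/andP[h0 hl] hl'] _] := approx _ (@ltr01 R).
have nitv : \forall st \near filter_prod (0 : R)^'+ (0 : R)^'+,
    -1 <= comparison_cos c c' st.1 st.2 <= 1.
  apply: (near0 _ _ h0) => s t /andP[s0 sh] /andP[t0 th].
  by apply: comparison_cos_itv; rewrite /= ?s0 ?t0 /= ?(le_trans sh)// (le_trans th).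
split=> //.
  apply/andP; split.
    by apply: (cvgr_to_ge cvq); apply: filterS nitv => x /andP[].
  by apply: (cvgr_to_le cvq); apply: filterS nitv => x /andP[].
rewrite /angle; apply: cvg_lim => //.
apply: (cvg_trans _ (cvg_acos nitv cvq)); apply: near_eq_cvg.
apply: (near0 _ _ h0) => s t /andP[s0 sh] /andP[t0 th] /=.
rewrite /comparison_angle (@geodesic_dist0 c s) ?(@geodesic_dist0 c' t)//.
  by rewrite (ltW t0) (le_trans th).
by rewrite (ltW s0) (le_trans sh).
Unshelve. all: by end_near. Qed.

Lemma angle_itv c c' : 0 <= angle c c' <= pi.
Proof. by have [q [q1 -> _ _]] := angleP c c'; rewrite acos_ge0// acos_lepi. Qed.

Lemma comparison_cos_le c c' (s t : R) : 0 < s <= len c -> 0 < t <= len c' ->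
  comparison_cos c c' s t <= cos (angle c c').
Proof.
by have [q [q1 -> ub _]] := angleP c c'; rewrite acosK ?in_itv//; exact: ub.
Qed.

Lemma comparison_cos_approx c c' (e : R) : 0 < e ->
  exists2 h : R, 0 < h <= len c /\ h <= len c' &
    forall s t : R, 0 < s <= h -> 0 < t <= h ->
    cos (angle c c') - e < comparison_cos c c' s t.
Proof.
by have [q [q1 -> _ ap]] := angleP c c'; rewrite acosK ?in_itv//; exact: ap.
Qed.

Lemma dist_ge_cos c c' (s t : R) : 0 <= s <= len c -> 0 <= t <= len c' ->
  s ^+ 2 + t ^+ 2 - 2 * s * t * cos (angle c c') <= d (c s) (c' t) ^+ 2.
Proof.
move=> /andP[+ sl] /andP[+ tl]; rewrite !le_eqVlt => /predU1P[s0|s0] /predU1P[t0|t0].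
- by rewrite -s0 -t0 !geodesic_start mdistxx; lra.
- rewrite -s0 geodesic_start geodesic_dist0 ?(ltW t0)//; lra.
- rewrite -t0 geodesic_start metric_sym geodesic_dist0 ?(ltW s0)//; lra.
rewrite comparison_cosE//.
have := @comparison_cos_le c c' s t; rewrite s0 t0 sl tl => /(_ isT isT).
by rewrite -(ler_pM2l (_ : 0 < 2 * s * t)) ?mulr_gt0//; lra.
Qed.

Lemma angle_refl c : angle c c = 0.
Proof.
have l0 := geodesic_length_gt0 c.
have c1 : cos (angle c c) = 1.
  apply/eqP; rewrite eq_le cos_le1 /=.
  have := @comparison_cos_le c c (len c) (len c); rewrite l0 lexx => /(_ isT isT).
  apply: le_trans; rewrite /comparison_cos mdistxx.
  by rewrite le_eqVlt; apply/orP; left; apply/eqP; field; lra.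
have := angle_itv c c => ai; rewrite -[LHS]cosK ?in_itv//= c1; exact: acos1.
Qed.

(** The distance between the unit vectors of the tangent cone in the directions
    of [c] and [c']. *)
Definition chord c c' : R := Num.sqrt (2 - 2 * cos (angle c c')).

Lemma chord_sqr c c' : chord c c' ^+ 2 = 2 - 2 * cos (angle c c').
Proof. by rewrite sqr_sqrtr// subr_ge0; have := cos_le1 (angle c c'); lra. Qed.

Lemma chord_le2 c c' : chord c c' <= 2.
Proof.
rewrite -(ler_pXn2r (_ : 0 < 2)%N) ?nnegrE ?sqrtr_ge0// chord_sqr.
by have := cos_geN1 (angle c c'); lra.
Qed.

Lemma chord_le c c' (s : R) : 0 < s <= len c -> s <= len c' ->
  s * chord c c' <= d (c s) (c' s).
Proof.
move=> /andP[s0 sl] sl'.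
rewrite -(ler_pXn2r (_ : 0 < 2)%N) ?nnegrE ?mdist_ge0//; last first.
  by rewrite mulr_ge0 ?sqrtr_ge0// ltW.
have := @dist_ge_cos c c' s s; rewrite sl sl' (ltW s0) => /(_ isT isT).
by rewrite exprMn chord_sqr; lra.
Qed.

Lemma chord_approx c c' (e : R) : 0 < e ->
  exists2 h : R, 0 < h & forall s, 0 < s <= h ->
    d (c s) (c' s) <= s * (chord c c' + e).
Proof.
move=> e0; have e2 : 0 < e ^+ 2 / 2 by rewrite divr_gt0// exprn_gt0.
have [h [/andP[h0 hl] hl'] Ph] := @comparison_cos_approx c c' _ e2.
exists h => // s /andP[s0 sh]; have ch0 : 0 <= chord c c' by exact: sqrtr_ge0.
rewrite -(ler_pXn2r (_ : 0 < 2)%N) ?nnegrE ?mdist_ge0//; last first.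
  by rewrite mulr_ge0 ?(ltW s0)//; lra.
have := Ph s s; rewrite s0 sh => /(_ isT isT) /ltW.
rewrite comparison_cosE// exprMn sqrrD chord_sqr => lt.
have : s ^+ 2 * 2 * (cos (angle c c') - e ^+ 2 / 2) <=
       s ^+ 2 * 2 * comparison_cos c c' s s.
  by rewrite ler_pM2l// mulr_gt0// exprn_gt0.
have : 0 <= s ^+ 2 * (chord c c' * e *+ 2).
  by rewrite mulr_ge0 ?sqr_ge0// mulrn_wge0// mulr_ge0// ltW.
by lra.
Qed.

(** Distances in [Y] near [p], rescaled by the distance to [p], converge to
    chords, which therefore inherit the triangle inequality. *)
Lemma chord_triangle c c' c'' : chord c c'' <= chord c c' + chord c' c''.
Proof.
apply/ler_addgt0Pr => e e0; have e20 : 0 < e / 2 by rewrite divr_gt0.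
have [h h0 H] := chord_approx c c' e20.
have [h' h'0 H'] := chord_approx c' c'' e20.
have l0 := geodesic_length_gt0 c; have l0'' := geodesic_length_gt0 c''.
pose s := Num.min (Num.min h h') (Num.min (len c) (len c'')).
have s0 : 0 < s by rewrite !lt_min h0 h'0 l0.
have sle x : x \in [:: h; h'; len c; len c''] -> s <= x.
  by rewrite !inE => /or4P[] /eqP ->; rewrite !ge_min lexx ?orbT.
have := H s; have := H' s; have := @chord_le c c'' s.
rewrite s0 !sle ?inE ?eqxx ?orbT// => /(_ isT isT) h1 /(_ isT) h2 /(_ isT) h3.
have := metric_triangle (c s) (c' s) (c'' s) => tri.
by rewrite -(ler_pM2l s0); lra.
Qed.

Lemma chord_small (e : R) : 0 < e -> exists2 h : R, 0 < h &
  forall c c', angle c c' < h -> chord c c' < e.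
Proof.
move=> e0; have e20 : 0 < e ^+ 2 / 2 by rewrite divr_gt0// exprn_gt0.
have := @continuous_cos R 0; move=> /cvgrPdist_lt /(_ _ e20) [h /= h0 H].
exists h => // c c' ang; have := H (angle c c'); rewrite /= sub0r normrN cos0.
have /andP[a0 _] := angle_itv c c'; rewrite ger0_norm// => /(_ ang).
rewrite ger0_norm ?subr_ge0 ?cos_le1// => lt.
rewrite -(ltr_pXn2r (_ : 0 < 2)%N) ?nnegrE ?sqrtr_ge0 1?ltW// chord_sqr.
by lra.
Qed.

(** The chords from [c] to the terms of a Cauchy sequence of directions form a
    Cauchy sequence by the triangle inequality, and chords determine cosines. *)
Lemma cauchy_cos_direction c W : cauchy (cos (angle c (W n)) @[n --> \oo]).
Proof.
apply/cauchyP => e e0; have [h h0 H] := chord_small (divr_gt0 e0 (ltr0n R 2)).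
have [n0 Hn] := direction_cauchy W h0.
exists (cos (angle c (W n0))); exists n0 => //= n n0n.
have c1 := H _ _ (Hn _ _ n0n (leqnn _)); have c2 := H _ _ (Hn _ _ (leqnn _) n0n).
have := chord_sqr c (W n); have := chord_sqr c (W n0).
have := chord_triangle c (W n) (W n0); have := chord_triangle c (W n0) (W n).
have := chord_le2 c (W n0); have := chord_le2 c (W n).
have : 0 <= chord c (W n) by exact: sqrtr_ge0.
have : 0 <= chord c (W n0) by exact: sqrtr_ge0.
set a := chord c (W n); set b := chord c (W n0) => b0 a0 a2 b2 t1 t2 E1 E2.
rewrite /ball /=; set x := cos _; set y := cos _.
have -> : x - y = (a - b) * (a + b) / 2 by rewrite /x /y; lra.
rewrite ltr_norml; apply/andP; split; nra.
Qed.

Lemma cvg_cos_direction c W : exists2 q : R,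
  cos (angle c (W n)) @[n --> \oo] --> q & lim (angle c (W n) @[n --> \oo]) = acos q.
Proof.
have : cvg (cos (angle c (W n)) @[n --> \oo]).
  by apply: R_complete; exact: cauchy_cos_direction.
move=> /cvg_ex[q cq].
exists q => //; apply: cvg_lim => //.
have ci : \forall n \near \oo, -1 <= cos (angle c (W n)) <= 1.
  by apply: nearW => n; rewrite cos_geN1 cos_le1.
apply: (cvg_trans _ (cvg_acos ci cq)); apply: near_eq_cvg; apply: nearW => n /=.
by rewrite cosK// in_itv /= angle_itv.
Qed.

Lemma constant_direction_cauchy c : forall e : R, 0 < e -> exists n0 : nat,
  forall n k, (n0 <= n)%N -> (n0 <= k)%N -> angle c c < e.
Proof. by move=> e e0; exists 0%N => *; rewrite angle_refl. Qed.

Definition constant_direction c : direction p :=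
  @Direction _ _ _ (fun _ => c) (@constant_direction_cauchy c).

Lemma direction_angle_constant c c' :
  direction_angle (constant_direction c) (constant_direction c') = angle c c'.
Proof.
rewrite /direction_angle /=; apply: lim_cst; exact: Rhausdorff.
Qed.

Lemma cos_direction_angle c W :
  cos (angle c (W n)) @[n --> \oo] --> cos (direction_angle (constant_direction c) W).
Proof.
have [q cq lq] := cvg_cos_direction c W; rewrite /direction_angle /= lq acosK//.
rewrite in_itv /=; apply/andP; split.
  by apply: (cvgr_to_ge cq); apply: nearW => n; exact: cos_geN1.
by apply: (cvgr_to_le cq); apply: nearW => n; exact: cos_le1.
Qed.

End Angles.

(** * Flexible tangent cones *)

Section Flexible.
Variables (R : realType) (T : Type) (d : T -> T -> R).

(** This bound makes the supremum in [delta] meaningful: the supremum of an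
    unbounded set would be zero by convention. *)
Lemma delta_of_le1 n (v : 'I_n -> T) (t : 'I_n -> R) (b : T) :
  (forall i, 0 < t i) -> \sum_i t i = 1 -> delta_of d v t b <= 1.
Proof.
move=> t0 t1; rewrite /delta_of; set A := [set _ | _].
have A0 r : A r -> 0 <= r.
  move=> [N [w _ ->]]; rewrite divr_ge0 ?sqr_ge0//.
  by apply: sumr_ge0 => i _; rewrite mulr_ge0 ?sqr_ge0// ltW.
have [->|/set0P[r Ar]] := eqVneq A set0; first by rewrite inf0.
apply: (@le_trans _ _ r); first by apply: ge_inf => //; exists 0.
have [N [w _ ->]] := Ar; set D := (X in _ / X).
have [->|D0] := eqVneq D 0; first by rewrite invr0 mulr0.
have Dp : 0 < D.
  rewrite lt_def D0 /=; apply: sumr_ge0 => i _.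
  by rewrite mulr_ge0 ?sqr_ge0// ltW.
by rewrite ler_pdivrMr// mul1r enorm_sum_le.
Qed.

(** A realization is assumed to exist because an infimum over the empty set is
    zero by convention, so that a vanishing infimum does not produce one. *)
Lemma flexible_realization n (v : 'I_n -> T) (t : 'I_n -> R) (b : T) (e : R) :
  flexible d -> (2 <= n)%N -> (forall i j, i != j -> d (v i) (v j) != 0) ->
  (forall i, 0 < t i) -> \sum_i t i = 1 -> barycenter d v t b ->
  (exists N (w : 'I_n -> 'rV[R]_N), realization d v b w) -> 0 < e ->
  exists N (w : 'I_n -> 'rV[R]_N), realization d v b w /\
    enorm (\sum_i t i *: w i) ^+ 2 / \sum_i t i * enorm (w i) ^+ 2 < e.
Proof.
move=> flex n2 vd t0 t1 bb [N0 [w0 rw0]] e0.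
pose A : set R := [set r : R | exists N, exists2 w : 'I_n -> 'rV[R]_N,
    realization d v b w &
    r = enorm (\sum_i t i *: w i) ^+ 2 / \sum_i t i * enorm (w i) ^+ 2].
have dle : delta_of d v t b <= 0.
  rewrite -flex; apply: ub_le_sup; last by exists n, v, t, b.
  by exists 1 => _ [k [v' [t' [b' [_ _ [? ?] _ ->]]]]]; exact: delta_of_le1.
have hA : has_inf A.
  split; first by eexists; exists N0, w0.
  exists 0 => _ [N [w _ ->]]; rewrite divr_ge0 ?sqr_ge0//.
  by apply: sumr_ge0 => i _; rewrite mulr_ge0 ?sqr_ge0// ltW.
have [_ [N [w rw ->]] lt] := inf_adherent e0 hA.
exists N, w; split=> //; apply: (lt_le_trans lt).
by rewrite -lerBrDr subrr; exact: dle.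
Qed.

End Flexible.

Section TangentRealization.
Variables (R : realType) (Y : metricType R) (p : Y).
Hypothesis cat : CAT0 Y.
Hypothesis flex : flexible (@cone_dist R Y p).
Local Notation d := mdist.
Local Notation len := geodesic_length.

Lemma cone_dist_sqr (a b : tangent_cone p) : cone_dist a b ^+ 2 =
  a.2%:num ^+ 2 + b.2%:num ^+ 2
  - 2 * a.2%:num * b.2%:num * cos (direction_angle a.1 b.1).
Proof.
have s0 : 0 <= a.2%:num by []. have t0 : 0 <= b.2%:num by [].
rewrite /cone_dist; set k := cos _; have k1 : k <= 1 by exact: cos_le1.
move: (a.2%:num) (b.2%:num) s0 t0 => s t s0 t0.
rewrite sqr_sqrtr//; have := mulr_ge0 s0 t0.
by have := sqr_ge0 (s - t); nra.
Qed.

(** The points of the cone are taken at the pairwise distinct radii 1, ..., n,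
    so that they are distinct whatever their directions, and the weights are
    divided by the radii: only the products of weights and radii matter for the
    apex to be the barycenter. *)
Lemma flexible_unit_vectors n (c : 'I_n.+1 -> geodesic_from p)
    (a : 'I_n.+1 -> R) (e : R) :
  (forall i, 0 < a i) ->
  (forall W : direction p,
    \sum_i a i * cos (direction_angle (constant_direction cat (c i)) W) <= 0) ->
  0 < e -> exists N (u : 'I_n.+1 -> 'rV[R]_N),
    [/\ forall i, enorm (u i) ^+ 2 = 1,
        forall i j, cos (angle (c i) (c j)) <= dot (u i) (u j)
      & enorm (\sum_i a i *: u i) ^+ 2 <= e].
Proof.
move=> a0 asum e0.
have n2 : (2 <= n.+1)%N.
  case: n c a a0 asum => // c a a0 /(_ (constant_direction cat (c ord0))).
  rewrite big_ord_recl big_ord0 addr0 direction_angle_constant angle_refl//.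
  by rewrite cos0 mulr1 leNgt a0.
pose rad (i : 'I_n.+1) : R := i.+1%:R.
have rad0 i : 0 < rad i by rewrite ltr0n.
pose S := \sum_i a i / rad i.
have S0 : 0 < S.
  rewrite /S big_ord_recl ltr_pwDl ?divr_gt0// sumr_ge0// => i _.
  by rewrite divr_ge0// ltW.
pose t i := a i / rad i / S.
have t0 i : 0 < t i by rewrite !divr_gt0.
have t1 : \sum_i t i = 1 by rewrite -mulr_suml divff// gt_eqF.
pose v (i : 'I_n.+1) : tangent_cone p :=
  (constant_direction cat (c i), NngNum (ltW (rad0 i))).
pose b : tangent_cone p := (constant_direction cat (c ord0), NngNum (lexx (0 : R))).
have vb i : cone_dist (v i) b ^+ 2 = rad i ^+ 2.
  by rewrite cone_dist_sqr /= expr0n addr0 mulr0 mul0r subr0.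
have bv i : cone_dist b (v i) = rad i.
  rewrite /cone_dist /= expr0n /= add0r mulr0 !mul0r subr0 sqrtr_sqr.
  by apply: ger0_norm; exact: ltW.
have vv i j : cone_dist (v i) (v j) ^+ 2 =
    rad i ^+ 2 + rad j ^+ 2 - 2 * rad i * rad j * cos (angle (c i) (c j)).
  by rewrite cone_dist_sqr /= direction_angle_constant.
have vvge i j : (rad i - rad j) ^+ 2 <= cone_dist (v i) (v j) ^+ 2.
  rewrite vv; have : cos (angle (c i) (c j)) <= 1 by exact: cos_le1.
  have : 0 < 2 * rad i * rad j by rewrite !mulr_gt0.
  by move=> h1 h2; have := ler_wpM2l (ltW h1) h2; lra.
have vd i j : i != j -> cone_dist (v i) (v j) != 0.
  move=> ij; apply: contraTneq (vvge i j) => ->; rewrite expr0n /= -ltNge.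
  rewrite lt_def sqr_ge0 andbT sqrf_eq0 subr_eq0 eqr_nat eqSS.
  by rewrite val_eqE.
have bb : barycenter (@cone_dist R Y p) v t b.
  move=> [W s]; have : 0 <= s%:num by [].
  set x := s%:num => x0.
  have -> : \sum_i t i * cone_dist (v i) (W, s) ^+ 2 =
      \sum_i t i * cone_dist (v i) b ^+ 2 + x ^+ 2 * (\sum_i t i)
      - 2 * x / S *
        \sum_i a i * cos (direction_angle (constant_direction cat (c i)) W).
    rewrite !mulr_sumr -big_split -sumrB /=; apply: eq_bigr => i _.
    rewrite vb cone_dist_sqr /= -/x /t; field.
    by rewrite !gt_eqF.
  rewrite t1 mulr1 -addrA lerDl.
  have := asum W; set z := \sum_i _ => z0.
  have : 0 <= 2 * x / S by rewrite divr_ge0 ?(ltW S0)// mulr_ge0.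
  by move=> h; have := sqr_ge0 x; nra.
(* vectors on a line realize all the radii *)
have ex : exists N (w : 'I_n.+1 -> 'rV[R]_N), realization (@cone_dist R Y p) v b w.
  exists 1%N, (fun i => const_mx (rad i)); split=> [i|i j].
    rewrite bv /enorm big_ord_recl big_ord0 addr0 mxE sqrtr_sqr.
    by apply: ger0_norm; exact: ltW.
  rewrite -(ler_pXn2r (_ : 0 < 2)%N) ?nnegrE ?sqrtr_ge0//.
  by rewrite enorm_sqr big_ord_recl big_ord0 addr0 !mxE; exact: vvge.
pose D := \sum_i t i * rad i ^+ 2.
have D0 : 0 < D.
  rewrite /D big_ord_recl; apply: ltr_pwDl; first by rewrite mulr_gt0// exprn_gt0.
  apply: sumr_ge0 => i _; by rewrite mulr_ge0 ?sqr_ge0// ltW.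
have e'0 : 0 < e / (S ^+ 2 * D) by rewrite divr_gt0// mulr_gt0// exprn_gt0.
have [N [w [[wn wd] lt]]] := flexible_realization flex n2 vd t0 t1 bb ex e'0.
have wE i : enorm (w i) = rad i by rewrite wn bv.
have u1 i : (rad i)^-1 ^+ 2 * rad i ^+ 2 = 1.
  by rewrite -exprMn mulVf ?expr1n// gt_eqF.
exists N, (fun i => (rad i)^-1 *: w i); split=> [i|i j|].
- by rewrite enormZ wE u1.
- rewrite dotZ.
  have := wd i j; rewrite -(ler_pXn2r (_ : 0 < 2)%N) ?nnegrE ?sqrtr_ge0// vv.
  have := enorm_lin_sub 1 1 (w i) (w j); rewrite !scale1r => ->.
  rewrite !wE => h; rewrite -(ler_pM2l (_ : 0 < rad i * rad j)) ?mulr_gt0//.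
  have -> : rad i * rad j * ((rad i)^-1 / rad j * dot (w i) (w j)) = dot (w i) (w j).
    by field; rewrite !gt_eqF.
  lra.
- have -> : \sum_i a i *: ((rad i)^-1 *: w i) = S *: \sum_i t i *: w i.
    rewrite scaler_sumr; apply: eq_bigr => i _; rewrite !scalerA /t.
    by congr (_ *: _); field; rewrite !gt_eqF.
  rewrite enormZ; move: lt.
  rewrite (_ : \sum_i t i * enorm (w i) ^+ 2 = D); last first.
    by apply: eq_bigr => i _; rewrite wE.
  rewrite ltr_pdivrMr// => /ltW; rewrite -(ler_pM2l (_ : 0 < S ^+ 2)) ?exprn_gt0//.
  move=> /le_trans; apply; rewrite le_eqVlt; apply/orP; left; apply/eqP.
  by field; rewrite !gt_eqF.
Qed.

End TangentRealization.

(** * First variation and realizations at a barycenter *)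

Section FirstVariation.
Variables (R : realType) (Y : metricType R) (p : Y).
Hypothesis cat : CAT0 Y.
Local Notation d := mdist.
Local Notation len := geodesic_length.

Lemma seq_uniform (I : eqType) (s : seq I) (P : I -> R -> Prop) :
  (forall i, i \in s -> exists2 h : R, 0 < h & forall x : R, 0 < x <= h -> P i x) ->
  exists2 h : R, 0 < h & forall i, i \in s -> forall x : R, 0 < x <= h -> P i x.
Proof.
elim: s => [|i s IH] Ps; first by exists 1.
have [h h0 Hh] := Ps i (mem_head _ _).
have [|h' h'0 Hh'] := IH; first by move=> j js; apply: Ps; rewrite inE js orbT.
exists (Num.min h h'); first by rewrite lt_min h0.
move=> j js x /andP[x0]; rewrite le_min => /andP[xh xh'].
move: js; rewrite inE => /predU1P[->|js]; first by apply: Hh; rewrite x0.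
by apply: Hh' => //; rewrite x0.
Qed.

(** The distance from [c (len c)] decreases along [W] at least at the rate
    given by the angle: compare through the point of [c] at distance [K * x]
    from [p], with [K] so large that the law of cosines is nearly affine. *)
Lemma first_variation (c W : geodesic_from p) (e : R) : 0 < e ->
  exists2 h : R, 0 < h & forall x : R, 0 < x <= h ->
    d (c (len c)) (W x) ^+ 2 <= len c ^+ 2
      - 2 * len c * x * (cos (angle c W) - e) + x ^+ 2 * (1 + e) ^+ 2.
Proof.
move=> e0; have e20 : 0 < e / 2 by rewrite divr_gt0.
have [h [/andP[h0 hl] hW] H] := comparison_cos_approx cat c W e20.
have k1 := cos_le1 (angle c W); have k2 := cos_geN1 (angle c W).
set k := cos _ in H k1 k2 *.
have [K [K0 Ke K2]] : exists K : R, [/\ 0 < K, K * e = 1 + 2 * e & 2 < K].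
  exists ((1 + 2 * e) / e); split; first by rewrite divr_gt0//; lra.
    by field; lra.
  by rewrite ltr_pdivlMr//; lra.
have hK0 : 0 < h / K by rewrite divr_gt0.
exists (h / K) => // x /andP[x0 xh].
have Kxh : K * x <= h by rewrite mulrC -ler_pdivlMr.
have Kx0 : 0 < K * x by rewrite mulr_gt0.
have xh' : x <= h by nra.
have l0 := geodesic_length_gt0 c; set r := len c in l0 *.
have dK : d (c (K * x)) (W x) <= x * (K - k + e).
  rewrite -(ler_pXn2r (_ : 0 < 2)%N) ?nnegrE ?mdist_ge0//; last first.
    by rewrite mulr_ge0 ?(ltW x0)//; lra.
  have := H (K * x) x; rewrite Kx0 x0 Kxh xh' => /(_ isT isT) /ltW.
  rewrite comparison_cosE// => lt.
  have : 2 * (K * x) * x * (k - e / 2) <=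
         2 * (K * x) * x * comparison_cos c W (K * x) x.
    apply: ler_wpM2l; last exact: lt.
    by apply: mulr_ge0 (ltW x0); apply: mulr_ge0 (ltW Kx0).
  have : x ^+ 2 * (1 + K ^+ 2 - 2 * K * k + K * e) <= (x * (K - k + e)) ^+ 2.
    rewrite exprMn ler_pM2l ?exprn_gt0//.
    have : 0 <= (k + e) ^+ 2 by rewrite sqr_ge0.
    by nra.
  by lra.
have dc : d (c r) (c (K * x)) = r - K * x.
  rewrite geodesic_dist ?lexx ?(ltW l0)// ?(ltW Kx0) /= ?(le_trans Kxh)//.
  by rewrite ger0_norm// subr_ge0 (le_trans Kxh).
have dr : d (c r) (W x) <= r - x * (k - e).
  by have := metric_triangle (c r) (c (K * x)) (W x); rewrite dc; lra.
have d0 : 0 <= d (c r) (W x) by exact: mdist_ge0.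
have : d (c r) (W x) ^+ 2 <= (r - x * (k - e)) ^+ 2 by nra.
have : x ^+ 2 * (k - e) ^+ 2 <= x ^+ 2 * (1 + e) ^+ 2.
  by rewrite ler_pM2l ?exprn_gt0//; nra.
by lra.
Qed.

(** Otherwise moving from [p] along [W] would decrease the dispersion. *)
Lemma barycenter_angles (I : eqType) (s : seq I) (t : I -> R) (v : I -> Y)
    (geo : I -> geodesic_from p) (W : geodesic_from p) :
  (forall i, i \in s -> 0 < t i) ->
  (forall i, v i != p -> len (geo i) = d p (v i) /\ geo i (d p (v i)) = v i) ->
  (forall q, dispersion s t v p <= dispersion s t v q) ->
  \sum_(i <- s) t i * d p (v i) * cos (angle (geo i) W) <= 0.
Proof.
move=> t0 geoP pmin; set z := \sum_(i <- s) _.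
pose A := \sum_(i <- s) t i * d p (v i); pose T := \sum_(i <- s) t i.
have A0 : 0 <= A.
  by rewrite /A big_seq sumr_ge0// => i /t0 ti; rewrite mulr_ge0 ?mdist_ge0 ?ltW.
have T0 : 0 <= T by rewrite /T big_seq sumr_ge0// => i /t0 /ltW.
apply/ler_addgt0Pr => e e0; rewrite add0r.
pose e1 := e / (2 * (A + 1)).
have A1 : 0 < 2 * (A + 1) by lra.
have e10 : 0 < e1 by rewrite divr_gt0.
have e1A : e1 * A <= e / 2.
  have : e1 * (A + 1) = e / 2 by rewrite /e1; field; lra.
  by have := mulr_ge0 (ltW e10) A0; lra.
have [|h h0 H] := @seq_uniform I s (fun i x => d (v i) (W x) ^+ 2 <=
   d p (v i) ^+ 2 - 2 * d p (v i) * x * (cos (angle (geo i) W) - e1)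
   + x ^+ 2 * (1 + e1) ^+ 2).
  move=> i _; have [->|vp] := eqVneq (v i) p.
    exists (len W); first exact: geodesic_length_gt0.
    move=> x /andP[x0 xl]; rewrite mdistxx geodesic_dist0 ?(ltW x0)//.
    have : x ^+ 2 <= x ^+ 2 * (1 + e1) ^+ 2.
      by rewrite ler_peMr ?sqr_ge0//; nra.
    by lra.
  have [lg gv] := geoP _ vp; have [h h0 Hh] := first_variation (geo i) W e10.
  by exists h => // x /Hh; rewrite lg gv.
pose M := (1 + e1) ^+ 2 * T.
have M0 : 0 <= M by rewrite mulr_ge0// sqr_ge0.
pose x := Num.min h (e / (M + 1)).
have x0 : 0 < x by rewrite lt_min h0 divr_gt0//; lra.
have xM : x * M <= e.
  have : x <= e / (M + 1) by rewrite ge_min lexx orbT.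
  by rewrite ler_pdivlMr; lra.
have xh : 0 < x <= h by rewrite x0 ge_min lexx.
have := pmin (W x).
have : dispersion s t v (W x) <=
       dispersion s t v p - 2 * x * (z - e1 * A) + x ^+ 2 * M.
  have -> : dispersion s t v p - 2 * x * (z - e1 * A) + x ^+ 2 * M =
      \sum_(i <- s) (t i * d (v i) p ^+ 2
        + ((- (2 * x)) * (t i * d p (v i) * cos (angle (geo i) W))
        + ((2 * x * e1) * (t i * d p (v i)) + (x ^+ 2 * (1 + e1) ^+ 2) * t i))).
    by rewrite !big_split /= -!mulr_sumr /dispersion -/z -/A /M -/T; ring.
  rewrite /dispersion !big_seq; apply: ler_sum => i si.
  have := ler_wpM2l (ltW (t0 _ si)) (H _ si _ xh).
  by rewrite [d (v i) p]metric_sym; lra.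
move=> h1 h2.
have : 2 * x * (z - e1 * A) <= x * (x * M) by lra.
have -> : 2 * x * (z - e1 * A) = x * (2 * (z - e1 * A)) by ring.
by rewrite ler_pM2l//; lra.
Qed.

End FirstVariation.

Section BarycenterRealization.
Variables (R : realType) (Y : metricType R).
Hypothesis had : hadamard Y.
Local Notation d := mdist.
Local Notation len := geodesic_length.

Lemma exists_geodesics (I : eqType) (v : I -> Y) (b : Y) (i0 : I) : v i0 != b ->
  exists geo : I -> geodesic_from b, forall i, v i != b ->
    len (geo i) = d b (v i) /\ geo i (d b (v i)) = v i.
Proof.
have [_ _ cat] := had.
have ex y : y != b -> exists g : geodesic_from b, len g = d b y /\ g (d b y) = y.
  move=> yb; have [c [c0 c1 cg]] := cat.1 b y.
  have l0 : 0 < d b y by rewrite mdist_gt0 eq_sym.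
  by exists (GeodesicFrom l0 c0 cg).
move=> /ex[g0 _].
have : forall i, exists g : geodesic_from b, v i != b ->
    len g = d b (v i) /\ g (d b (v i)) = v i.
  move=> i; have [vb|/ex[g gP]] := eqVneq (v i) b; first by exists g0.
  by exists g.
by move=> /choice[geo geoP]; exists geo.
Qed.

(** At a barycenter [b] of points of [Y] the images of these points in the
    tangent cone have the apex as barycenter, their distances to the apex are
    the distances to [b], and their mutual distances have not increased. *)
Theorem barycenter_realization (I : eqType) (s : seq I) (t : I -> R)
    (v : I -> Y) (b : Y) (e : R) :
  flexible (@cone_dist R Y b) -> uniq s -> (forall i, i \in s -> 0 < t i) ->
  (forall q, dispersion s t v b <= dispersion s t v q) -> 0 < e ->
  exists N (u : I -> 'rV[R]_N),
    [/\ forall i, i \in s -> enorm (u i) ^+ 2 = d b (v i) ^+ 2,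
        forall i j, i \in s -> j \in s ->
          enorm (u i - u j) ^+ 2 <= d (v i) (v j) ^+ 2
      & enorm (\sum_(i <- s) t i *: u i) ^+ 2 <= e].
Proof.
have [_ _ cat] := had; move=> flex us t0 bmin e0.
(* points equal to [b] have no direction; they are realized by the origin *)
pose s' := [seq i <- s | v i != b].
have s'P i : i \in s -> (i \in s') = (v i != b).
  by move=> si; rewrite mem_filter si andbT.
have us' : uniq s' by rewrite filter_uniq.
have enorm0 N : enorm (0 : 'rV[R]_N) ^+ 2 = 0.
  by rewrite enorm_sqr big1// => i _; rewrite mxE expr0n.
have [s'0|[i0 i0s']] : s' = [::] \/ exists i0, i0 \in s'.
- case E : s' => [|i s'']; [by left | right; exists i; exact: mem_head].
- have vb i : i \in s -> v i = b.
    by move=> si; apply/eqP/negPn; rewrite -s'P// s'0.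
  exists 0%N, (fun _ => 0); split=> [i si|i j si sj|].
  + by rewrite vb// mdistxx expr0n enorm0.
  + by rewrite subr0 enorm0 sqr_ge0.
  + by rewrite big1 ?enorm0 ?(ltW e0)// => i _; rewrite scaler0.
have i0b : v i0 != b by move: i0s'; rewrite mem_filter => /andP[].
have [geo geoP] := exists_geodesics i0b.
have [n nE] : exists n, size s' = n.+1.
  by case E : s' i0s' => [|i s''] // _; exists (size s'').
have sumE (M : nmodType) (F : I -> M) :
    \sum_(j < n.+1) F (nth i0 s' j) = \sum_(i <- s | v i != b) F i.
  by rewrite -[RHS]big_filter -/s' [RHS](big_nth i0) nE big_mkord.
pose c (j : 'I_n.+1) := geo (nth i0 s' j).
pose a (j : 'I_n.+1) := t (nth i0 s' j) * d b (v (nth i0 s' j)).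
have nths (j : 'I_n.+1) : nth i0 s' j \in s'.
  by rewrite mem_nth// nE.
have a0 j : 0 < a j.
  have := nths j; rewrite mem_filter => /andP[vb si].
  by rewrite mulr_gt0 ?t0// mdist_gt0 eq_sym.
have asum (W : direction b) :
    \sum_j a j * cos (direction_angle (constant_direction cat (c j)) W) <= 0.
  have cvgs : \sum_j a j * cos (angle (c j) (W k)) @[k --> \oo] -->
      \sum_j a j * cos (direction_angle (constant_direction cat (c j)) W).
    apply: cvg_big; first by move=> ? ?; exact: add_continuous.
    by move=> j _; apply: cvgMl_tmp; exact: cos_direction_angle.
  apply: (cvgr_to_le cvgs); apply: nearW => k.
  have := barycenter_angles cat (W k) t0 geoP bmin.
  rewrite [X in X <= _](bigID (fun i => v i != b)) /= [X in _ + X]big1 ?addr0.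
    by rewrite -(sumE _ (fun i => t i * d b (v i) * cos (angle (geo i) (W k)))).
  by move=> i /negPn/eqP ->; rewrite mdistxx mulr0 mul0r.
have [N [w [w1 wd we]]] := flexible_unit_vectors flex a0 asum e0.
pose u i : 'rV[R]_N :=
  if i \in s' then d b (v i) *: w (inord (index i s')) else 0.
have uE i : i \in s -> v i != b -> u i = d b (v i) *: w (inord (index i s')).
  by move=> si vb; rewrite /u s'P// vb.
have u0 i : v i = b -> u i = 0 by rewrite /u mem_filter => ->; rewrite eqxx.
have un i : i \in s -> enorm (u i) ^+ 2 = d b (v i) ^+ 2.
  move=> si; have [vb|vb] := eqVneq (v i) b.
    by rewrite u0// enorm0 vb mdistxx expr0n.
  by rewrite uE// enormZ w1 mulr1.
have cE i : i \in s -> v i != b -> c (inord (index i s')) = geo i.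
  move=> si vb; have is' : i \in s' by rewrite s'P.
  by rewrite /c inordK ?nth_index// -nE index_mem.
exists N, u; split=> // [i j si sj|].
  have [vi|vi] := eqVneq (v i) b.
    by rewrite (u0 i)// sub0r -scaleN1r enormZ sqrrN expr1n mul1r un// vi.
  have [vj|vj] := eqVneq (v j) b.
    by rewrite (u0 j)// subr0 un// vj metric_sym.
  rewrite uE// uE// enorm_lin_sub !w1 !mulr1.
  have [li gi] := geoP _ vi; have [lj gj] := geoP _ vj.
  have := @dist_ge_cos _ _ _ cat (geo i) (geo j) (d b (v i)) (d b (v j)).
  rewrite li lj gi gj !mdist_ge0 !lexx => /(_ isT isT); apply: le_trans.
  have := wd (inord (index i s')) (inord (index j s')); rewrite !cE// => le.
  have : 0 <= 2 * d b (v i) * d b (v j) by rewrite !mulr_ge0 ?mdist_ge0.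
  by move=> /ler_wpM2l /(_ _ _ le); lra.
rewrite (_ : \sum_(i <- s) _ = \sum_j a j *: w j)//.
rewrite (bigID (fun i => v i != b)) /= [X in _ + X]big1 ?addr0; last first.
  by move=> i /negPn/eqP vb; rewrite u0// scaler0.
rewrite -(sumE _ (fun i => t i *: u i)); apply: eq_bigr => j _.
have := nths j; rewrite mem_filter => /andP[vb si].
by rewrite uE// scalerA index_uniq ?nE// inord_val.
Qed.

End BarycenterRealization.

(** * Poincare inequality of a weighted graph *)

Section SpectralGap.
Variables (R : realType) (n : nat) (a : 'I_n -> R) (b : 'I_n -> 'I_n -> R).
Hypothesis a_gt0 : forall i, 0 < a i.
Hypothesis b_ge0 : forall i j, 0 <= b i j.
Hypothesis b_sym : forall i j, b i j = b j i.
Hypothesis b_sum : forall i, \sum_j b i j = a i.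
Implicit Types f g h : 'I_n -> R.

Definition wdot f g : R := \sum_i a i * f i * g i.

Definition dirichlet f g : R := \sum_i (a i * f i - \sum_j b i j * f j) * g i.

Lemma dirichletE f : dirichlet f f = 2^-1 * \sum_i \sum_j b i j * (f i - f j) ^+ 2.
Proof.
have sq : \sum_i \sum_j b i j * (f i - f j) ^+ 2 =
    \sum_i \sum_j b i j * f i ^+ 2 - 2 * (\sum_i \sum_j b i j * f j * f i)
    + \sum_i \sum_j b i j * f j ^+ 2.
  rewrite mulr_sumr -sumrB -big_split /=; apply: eq_bigr => i _.
  rewrite mulr_sumr -sumrB -big_split /=; apply: eq_bigr => j _; ring.
have e1 : \sum_i \sum_j b i j * f i ^+ 2 = \sum_i a i * f i ^+ 2.
  by apply: eq_bigr => i _; rewrite -mulr_suml b_sum.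
have e2 : \sum_i \sum_j b i j * f j ^+ 2 = \sum_i a i * f i ^+ 2.
  rewrite exchange_big /= -e1; apply: eq_bigr => i _; apply: eq_bigr => j _.
  by rewrite b_sym.
rewrite sq e1 e2 /dirichlet.
have -> : \sum_i (a i * f i - \sum_j b i j * f j) * f i =
    \sum_i a i * f i ^+ 2 - \sum_i \sum_j b i j * f j * f i.
  rewrite -sumrB; apply: eq_bigr => i _; rewrite mulrBl mulr_suml; congr (_ - _).
  by ring.
by lra.
Qed.

Lemma dirichlet_ge0 f : 0 <= dirichlet f f.
Proof.
rewrite dirichletE mulr_ge0// sumr_ge0// => i _; rewrite sumr_ge0// => j _.
by rewrite mulr_ge0// sqr_ge0.
Qed.

Lemma dirichlet_sym f g : dirichlet f g = dirichlet g f.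
Proof.
have E f' g' : dirichlet f' g' =
    \sum_i a i * f' i * g' i - \sum_i \sum_j b i j * (f' j * g' i).
  rewrite -sumrB; apply: eq_bigr => i _; rewrite mulrBl mulr_suml; congr (_ - _).
  by apply: eq_bigr => j _; rewrite mulrA.
rewrite !E; congr (_ - _); first by apply: eq_bigr => i _; ring.
rewrite exchange_big /=; apply: eq_bigr => i _; apply: eq_bigr => j _.
by rewrite b_sym [f i * _]mulrC.
Qed.

Lemma dirichletDr f g h (e : R) :
  dirichlet f (fun i => g i + e * h i) = dirichlet f g + e * dirichlet f h.
Proof.
rewrite mulr_sumr -big_split /=; apply: eq_bigr => i _; ring.
Qed.

Lemma dirichletDl f g h (e : R) :
  dirichlet (fun i => g i + e * h i) f = dirichlet g f + e * dirichlet h f.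
Proof. by rewrite dirichlet_sym dirichletDr ![dirichlet f _]dirichlet_sym. Qed.

Lemma dirichlet_cst (c : R) f : dirichlet (fun _ => c) f = 0.
Proof. by apply: big1 => i _; rewrite -mulr_suml b_sum subrr mul0r. Qed.

Lemma wdotC f g : wdot f g = wdot g f.
Proof. by apply: eq_bigr => i _; ring. Qed.

Lemma wdotDr f g h (e : R) :
  wdot f (fun i => g i + e * h i) = wdot f g + e * wdot f h.
Proof. rewrite mulr_sumr -big_split /=; apply: eq_bigr => i _; ring. Qed.

Lemma wdotDl f g h (e : R) :
  wdot (fun i => g i + e * h i) f = wdot g f + e * wdot h f.
Proof. by rewrite wdotC wdotDr ![wdot f _]wdotC. Qed.

Lemma wdot_ge0 f : 0 <= wdot f f.
Proof.
by apply: sumr_ge0 => i _; rewrite -mulrA mulr_ge0 -?expr2 ?sqr_ge0// ltW.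
Qed.

Lemma wdot_eq0 f : wdot f f = 0 -> forall i, f i = 0.
Proof.
move=> /eqP; rewrite psumr_eq0 => [/allP f0 i|i _]; last first.
  by rewrite -mulrA mulr_ge0 -?expr2 ?sqr_ge0// ltW.
have := f0 i (mem_index_enum i); rewrite /= -mulrA mulf_eq0 gt_eqF//=.
by rewrite mulf_eq0 orbb => /eqP.
Qed.

Lemma linear_coef0 (x y : R) : (forall e, 0 <= 2 * e * x + e ^+ 2 * y) -> x = 0.
Proof.
move=> H; have c0 : 0 < `|y| + 1 by rewrite ltr_pwDr.
have yc := ler_norm y; set c := `|y| + 1 in c0 *.
have := H (- x / c).
have -> : 2 * (- x / c) * x + (- x / c) ^+ 2 * y = x ^+ 2 * ((y - 2 * c) / c ^+ 2).
  by field; rewrite gt_eqF.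
move=> h; apply/eqP; rewrite -sqrf_eq0 eq_le sqr_ge0 andbT leNgt; apply/negP => x0.
move: h; rewrite pmulr_rge0// pmulr_lge0 ?invr_gt0 ?exprn_gt0//.
by have := normr_ge0 y; rewrite /c; lra.
Qed.

Let one : 'I_n -> R := fun _ => 1.

(** The unit sphere of the functions of mean zero is compact, and the Dirichlet
    form is continuous and homogeneous. *)
Lemma rayleigh_min g : wdot one g = 0 -> wdot g g != 0 ->
  exists f, [/\ wdot one f = 0, wdot f f = 1 &
    forall h, wdot one h = 0 -> dirichlet f f * wdot h h <= dirichlet h h].
Proof.
pose fn (v : 'rV[R]_n) i := v 0 i.
have coordc i : continuous (fun v : 'rV[R]_n => v 0 i) by exact: coord_continuous.
have sumc (F : 'I_n -> 'rV[R]_n -> R) : (forall i, continuous (F i)) ->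
    continuous (fun v => \sum_i F i v).
  move=> Fc; apply: continuous_big => [|i _]; last exact: Fc.
  by move=> ?; exact: add_continuous.
have cstc (c : R) : continuous (fun _ : 'rV[R]_n => c) by exact: cst_continuous.
have mulc (F G : 'rV[R]_n -> R) : continuous F -> continuous G ->
    continuous (fun v => F v * G v).
  by move=> Fc Gc v; exact: (continuousM (Fc v) (Gc v)).
have subc (F G : 'rV[R]_n -> R) : continuous F -> continuous G ->
    continuous (fun v => F v - G v).
  by move=> Fc Gc v; exact: (continuousB (Fc v) (Gc v)).
have Mc : continuous (fun v => wdot one (fn v)).
  by apply: sumc => i; apply: (mulc (fun _ => a i * one i) (fun v => v 0 i)).
have coefc (x : R) i : continuous (fun v : 'rV[R]_n => x * v 0 i).
  by apply: (mulc (fun _ => x) (fun v => v 0 i)).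
have Nc : continuous (fun v => wdot (fn v) (fn v)).
  by apply: sumc => i; apply: (mulc (fun v => a i * v 0 i) (fun v => v 0 i)).
have Dc : continuous (fun v => dirichlet (fn v) (fn v)).
  apply: (sumc) => i.
  apply: (mulc (fun v => a i * v 0 i - \sum_j b i j * v 0 j) (fun v => v 0 i)).
    2: exact: coordc.
  apply: (subc (fun v => a i * v 0 i) (fun v => \sum_j b i j * v 0 j)).
    exact: coefc.
  by apply: (sumc (fun j v => b i j * v 0 j)).
pose K : set 'rV[R]_n := [set v | wdot one (fn v) = 0] `&`
  [set v | wdot (fn v) (fn v) = 1].
have Kclosed : closed K.
  apply: closedI.
    exact: ((continuous_closedP _).1 Mc _ (@closed_eq R 0)).
  exact: ((continuous_closedP _).1 Nc _ (@closed_eq R 1)).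
have Kcompact : compact K.
  pose box i := `[- (1 + (a i)^-1), 1 + (a i)^-1]%classic : set R.
  apply: (subclosed_compact Kclosed (@rV_compact R n box _)).
    by move=> i; exact: segment_compact.
  move=> v [_ v1] i; rewrite /box /= in_itv /=.
  have h : a i * v 0 i ^+ 2 <= 1.
    move: v1; rewrite /= /wdot (bigD1 i)//= /fn => <-.
    rewrite -mulrA -expr2 lerDl sumr_ge0// => j _.
    by rewrite -mulrA mulr_ge0 -?expr2 ?sqr_ge0// ltW.
  have h' : v 0 i ^+ 2 <= (a i)^-1.
    by rewrite -[leRHS]mulr1 -ler_pdivrMl ?invrK ?invr_gt0.
  have ai0 : 0 < (a i)^-1 by rewrite invr_gt0.
  by rewrite -ler_norml -(ler_pXn2r (_ : 0 < 2)%N) ?nnegrE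
    ?real_normK ?num_real//; nra.
move=> g0 gN; have gg : 0 < wdot g g by rewrite lt_def gN wdot_ge0.
(* rescaling to the unit sphere *)
have scale h : wdot one h = 0 -> 0 < wdot h h ->
    exists2 v : 'rV[R]_n, K v & dirichlet h h = dirichlet (fn v) (fn v) * wdot h h.
  move=> h0 hh; pose r := Num.sqrt (wdot h h); have r0 : 0 < r by rewrite sqrtr_gt0.
  have rr : r ^+ 2 = wdot h h by rewrite sqr_sqrtr// ltW.
  pose v : 'rV[R]_n := \row_i (h i / r).
  have hE : h = (fun i => 0 + r * fn v i).
    by apply/funext => i; rewrite /fn mxE add0r mulrC divfK// gt_eqF.
  have zero f : wdot f (fun _ => 0) = 0 /\ dirichlet f (fun _ => 0) = 0.
    by split; apply: big1 => i _; rewrite mulr0.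
  have w0 : wdot h h = r ^+ 2 * wdot (fn v) (fn v).
    rewrite {1 2}hE wdotDr wdotDl wdotDl !(zero _).1.
    rewrite !(wdotC (fun _ => 0)) !(zero _).1.
    by ring.
  exists v; last first.
    rewrite {1 2}hE dirichletDr dirichletDl dirichletDl !(zero _).2.
    by rewrite !(dirichlet_sym (fun _ => 0)) !(zero _).2 -rr; ring.
  split => /=.
    move: h0; rewrite {1}hE wdotDr (zero _).1 add0r => /eqP.
    by rewrite mulf_eq0 gt_eqF//= => /eqP.
  by apply: (mulfI (lt0r_neq0 hh)); rewrite mulr1 -{1}rr -w0.
have K0 : K !=set0 by have [v Kv _] := scale g g0 gg; exists v.
have [c /set_mem Kc cmin] := EVT_min_rV K0 Kcompact (continuous_subspaceT Dc).
have [c0 c1] := Kc; exists (fn c); split=> // h h0.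
have [hh|hh] := eqVneq (wdot h h) 0; first by rewrite hh mulr0 dirichlet_ge0.
have hp : 0 < wdot h h by rewrite lt_def hh wdot_ge0.
have [v Kv ->] := scale h h0 hp.
by rewrite ler_wpM2r// ?wdot_ge0//; apply: cmin; exact/mem_set.
Qed.

(** A minimizer of the Dirichlet form is an eigenfunction of the Laplacian, and
    its eigenvalue is the minimum; it is not zero because a function of zero
    Dirichlet form is constant on a connected graph. *)
Theorem spectral_gap (mu : R) :
  (forall f, (forall i j, 0 < b i j -> f i = f j) -> forall i j, f i = f j) ->
  (forall (l : R) f, l != 0 -> (exists i, f i != 0) ->
     (forall i, f i - \sum_j b i j / a i * f j = l * f i) -> mu <= l) ->
  forall f, wdot one f = 0 -> mu * wdot f f <= dirichlet f f.
Proof.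
move=> conn eig g g0; have [gN|gN] := eqVneq (wdot g g) 0.
  by rewrite gN mulr0 dirichlet_ge0.
have [f [f0 f1 fmin]] := rayleigh_min g0 gN.
set l := dirichlet f f in fmin.
have lin h : wdot one h = 0 -> dirichlet f h = l * wdot f h.
  move=> h0; apply/eqP; rewrite -subr_eq0; apply/eqP.
  apply: (@linear_coef0 _ (dirichlet h h - l * wdot h h)) => e.
  have := fmin (fun i => f i + e * h i).
  rewrite wdotDr f0 h0 mulr0 addr0 => /(_ erefl).
  rewrite !(wdotDr, wdotDl) !(dirichletDr, dirichletDl) f1 (wdotC h f).
  by rewrite (dirichlet_sym h f) -/l; lra.
(* the test function is the Dirac function at [i], made orthogonal to [one] *)
have eqf i : a i * f i - \sum_j b i j * f j = l * (a i * f i).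
  pose A := wdot one one; pose dl : 'I_n -> R := fun j => (j == i)%:R.
  have A0 : A != 0.
    by apply/eqP => /wdot_eq0 /(_ i) /eqP; rewrite /one oner_eq0.
  have sdl (F : 'I_n -> R) : \sum_j F j * dl j = F i.
    rewrite (bigD1 i)//= /dl eqxx mulr1 big1 ?addr0// => j /negPf ->.
    by rewrite mulr0.
  pose h j := dl j + (- (a i / A)) * one j.
  have h0 : wdot one h = 0.
    rewrite /h wdotDr -/A {1}/wdot (sdl (fun j => a j * one j)) /one mulr1.
    by field.
  have := lin h h0; rewrite /h dirichletDr wdotDr.
  rewrite (dirichlet_sym f one) dirichlet_cst mulr0 addr0.
  rewrite (wdotC f one) f0 mulr0 addr0.
  by rewrite /dirichlet (sdl (fun j => _ - _)) /wdot (sdl (fun j => a j * f j)).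
have l0 : l != 0.
  apply/eqP => l0; have cst : forall i j, f i = f j.
    apply: conn => i j bij; apply/eqP; rewrite -subr_eq0 -sqrf_eq0.
    have := l0; rewrite /l dirichletE => /eqP; rewrite mulf_eq0 invr_eq0 pnatr_eq0 /=.
    rewrite psumr_eq0 => [/allP /(_ i (mem_index_enum i)) /=|k _]; last first.
      by apply: sumr_ge0 => k' _; rewrite mulr_ge0 ?sqr_ge0.
    rewrite psumr_eq0 => [/allP /(_ j (mem_index_enum j)) /=|k _]; last first.
      by rewrite mulr_ge0 ?sqr_ge0.
    by rewrite mulf_eq0 gt_eqF.
  have f00 i : f i = 0.
    have := f0; rewrite /wdot; under eq_bigr => j _ do rewrite (cst j i) /one mulr1.
    rewrite -mulr_suml => /eqP; rewrite mulf_eq0 => /orP[|/eqP//].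
    rewrite psumr_eq0 => [/allP /(_ i (mem_index_enum i)) /=|k _]; last exact: ltW.
    by rewrite gt_eqF.
  have := f1; rewrite /wdot big1 => [/esym/eqP|i _]; last by rewrite f00 mulr0.
  by rewrite oner_eq0.
have ml : mu <= l.
  apply: (eig l f l0).
    apply/not_existsP => fz; have := f1; rewrite /wdot big1 => [/esym/eqP|i _].
      by rewrite oner_eq0.
    by have /negP/negPn/eqP -> := fz i; rewrite mulr0.
  move=> i; have ai : a i != 0 by rewrite gt_eqF.
  apply: (mulfI ai); rewrite mulrBr mulr_sumr mulrCA -eqf; congr (_ - _).
  by apply: eq_bigr => j _; field.
by apply: le_trans (fmin g g0); rewrite ler_wpM2r ?wdot_ge0.
Qed.

Corollary poincare (mu : R) :
  (forall f, (forall i j, 0 < b i j -> f i = f j) -> forall i j, f i = f j) ->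
  (forall (l : R) f, l != 0 -> (exists i, f i != 0) ->
     (forall i, f i - \sum_j b i j / a i * f j = l * f i) -> mu <= l) ->
  forall f, mu * (\sum_i a i * f i ^+ 2 - (\sum_i a i * f i) ^+ 2 / \sum_i a i)
    <= 2^-1 * \sum_i \sum_j b i j * (f i - f j) ^+ 2.
Proof.
move=> conn eig f; rewrite -dirichletE.
pose A := \sum_i a i; pose M := \sum_i a i * f i.
pose g i := f i + (- (M / A)) * one i.
have oneE h : wdot one h = \sum_i a i * h i.
  by apply: eq_bigr => i _; rewrite /one mulr1.
have AE : wdot one one = A by rewrite oneE; apply: eq_bigr => i _; rewrite /one mulr1.
have [A0|A0] := eqVneq A 0.
  have n0 : 'I_n -> False.
    move=> i; have := wdot_eq0 (etrans AE A0) i => /eqP; rewrite /one oner_eq0//.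
  rewrite big1 => [|i _]; last by case: (n0 i).
  rewrite [\sum_i a i * f i]big1 => [|i _]; last by case: (n0 i).
  by rewrite expr0n /= mul0r subr0 mulr0 dirichlet_ge0.
have g0 : wdot one g = 0 by rewrite wdotDr AE oneE -/M; field.
have := spectral_gap conn eig g0.
rewrite !(wdotDr, wdotDl) !(dirichletDr, dirichletDl) AE.
rewrite (dirichlet_sym f one) !dirichlet_cst (wdotC f one) oneE -/M.
have -> : wdot f f = \sum_i a i * f i ^+ 2 by apply: eq_bigr => i _; ring.
rewrite -/A; set W := \sum_i _; rewrite !mulr0 !addr0.
have -> : W + - (M / A) * M + - (M / A) * (M + - (M / A) * A) = W - M ^+ 2 / A.
  by field.
by move=> h; lra.
Qed.

End SpectralGap.

(** * Links of vertices *)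

Section Links.
Variables (R : realType) (V : choiceType) (X : complex V) (m : {fset V} -> R).
Hypothesis X_lf : locally_finite X.
Hypothesis m_adm : admissible_weight X m.
Implicit Types (x y z : V).

Lemma ordered_edge_sym x y : ordered_edge X x y -> ordered_edge X y x.
Proof. by move=> [xy Xxy]; split; rewrite 1?eq_sym// fsetUC. Qed.

Lemma ordered_edge_vertices x y : ordered_edge X x y -> vertices X x /\ vertices X y.
Proof.
by move=> [xy Xxy]; split; apply: (simplices_sub Xxy);
  rewrite ?fsub1set ?inE ?eqxx ?orbT//; apply/fset0Pn;
  [exists x | exists y]; rewrite inE.
Qed.

(** The enumeration of a finite set; in a locally finite complex the set of the
    neighbors of a vertex is finite. *)
Definition neighbors x : seq V := fset_set [set y | ordered_edge X x y].

Lemma finite_neighbors x : finite_set [set y | ordered_edge X x y].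
Proof.
have [vx|vx] := pselect (vertices X x); last first.
  rewrite (_ : [set _ | _] = set0)//; apply/seteqP; split=> // y /=.
  by move=> /ordered_edge_vertices[].
have fin : finite_set (\bigcup_(s in [set s | X s /\ x \in s]) [set` s]).
  by apply: bigcup_finite => [|s _]; [exact: X_lf | exact: finite_fset].
apply: sub_finite_set fin => y /= [xy Xxy].
by exists [fset x; y]%fset; rewrite /= ?inE ?eqxx ?orbT.
Qed.

Lemma neighborsP x y : reflect (ordered_edge X x y) (y \in neighbors x).
Proof.
apply: (iffP idP) => [|xy].
  by rewrite in_fset_set ?inE//; exact: finite_neighbors.
by rewrite in_fset_set ?inE//; exact: finite_neighbors.
Qed.

Lemma neighbors_uniq x : uniq (neighbors x).
Proof. exact: fset_uniq. Qed.

Lemma neighbors_sym x y : (y \in neighbors x) = (x \in neighbors y).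
Proof. by apply/idP/idP => /neighborsP/ordered_edge_sym/neighborsP. Qed.

Definition triangle x y z : bool :=
  [&& x != y, x != z, y != z & `[< X [fset x; y; z]%fset >] ].

Definition edge_weight x y : R := m [fset x; y]%fset.

Definition triangle_weight x y z : R :=
  if triangle x y z then m [fset x; y; z]%fset else 0.

Lemma triangleCA x y z : triangle x y z = triangle y x z.
Proof.
rewrite /triangle [y == x]eq_sym [[fset y; x]%fset]fsetUC.
by case: (x == y); case: (x == z); case: (y == z); case: (asbool _).
Qed.

Lemma triangleAC x y z : triangle x y z = triangle x z y.
Proof.
rewrite /triangle [z == y]eq_sym [[fset x; z; y]%fset]fsetUAC.
by case: (x == y); case: (x == z); case: (y == z); case: (asbool _).
Qed.

Lemma triangle_weightCA x y z : triangle_weight x y z = triangle_weight y x z.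
Proof. by rewrite /triangle_weight triangleCA [[fset y; x]%fset]fsetUC. Qed.

Lemma triangle_weightAC x y z : triangle_weight x y z = triangle_weight x z y.
Proof. by rewrite /triangle_weight triangleAC [[fset x; z; y]%fset]fsetUAC. Qed.

Lemma edge_weightC x y : edge_weight x y = edge_weight y x.
Proof. by rewrite /edge_weight fsetUC. Qed.

Lemma triangle_weight_ge0 x y z : 0 <= triangle_weight x y z.
Proof.
rewrite /triangle_weight; case: ifP => // /and4P[_ _ _ /asboolP Xt].
exact/ltW/m_adm.1.
Qed.

Lemma edge_weight_gt0 x y : y \in neighbors x -> 0 < edge_weight x y.
Proof. by move=> /neighborsP[_ Xxy]; exact: m_adm.1. Qed.

Lemma triangle_edge x y z : triangle x y z -> ordered_edge X x y.
Proof.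
move=> /and4P[xy xz yz /asboolP Xt]; split=> //.
apply: (simplices_sub Xt); first exact: fsubsetUl.
by apply/fset0Pn; exists x; rewrite !inE eqxx.
Qed.

Lemma link_edgeP x y z : ordered_edge (link X x) y z <-> triangle x y z.
Proof.
rewrite /ordered_edge /= /link_set /= fsetUA.
split=> [[yz [_]]|/and4P[xy xz yz /asboolP Xt]].
  by rewrite !inE negb_or => /andP[xy xz] Xt; apply/and4P; split=> //; exact/asboolP.
split=> //; split=> //; last by rewrite !inE negb_or xy.
by apply/fset0Pn; exists y; rewrite !inE eqxx.
Qed.

Lemma link_vertexP x y : vertices (link X x) y <-> y \in neighbors x.
Proof.
rewrite /vertices /= /link_set /=; split=> [[_]|/neighborsP[xy Xxy]].
  by rewrite inE => xy Xxy; apply/neighborsP.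
by split=> //; [apply/fset0Pn; exists y; rewrite inE | rewrite inE].
Qed.

Lemma triangle_neighbors x y z : triangle x y z ->
  [/\ y \in neighbors x, z \in neighbors x & z \in neighbors y].
Proof.
move=> t; split; apply/neighborsP; first exact: triangle_edge t.
  by move: t; rewrite triangleAC; exact: triangle_edge.
by move: t; rewrite triangleCA triangleAC; exact: triangle_edge.
Qed.

Lemma sum_link_edges x y (F : V -> R) :
  \sum_(z \in [set z | ordered_edge (link X x) y z]) F z =
  \sum_(z <- neighbors x) if triangle x y z then F z else 0.
Proof.
rewrite (fsbig_seq _ _ (neighbors_uniq x)).
have -> : [set z | ordered_edge (link X x) y z] =
    [set` neighbors x] `&` [set z | triangle x y z].
  apply/seteqP; split=> z /=.
    by move=> /link_edgeP t; split=> //; have [] := triangle_neighbors t.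
  by move=> [_ t]; exact/link_edgeP.
rewrite fsbig_mkcondr; apply: eq_fsbigr => z _.
by congr (if _ then _ else _); apply/idP/idP; rewrite inE.
Qed.

(** The cofaces of the edge are the triangles that contain it, and a triangle is
    determined by its third vertex. *)
Lemma sum_triangle_weight x y : y \in neighbors x ->
  (exists z, triangle x y z) ->
  \sum_(z <- neighbors x) triangle_weight x y z = edge_weight x y.
Proof.
move=> /neighborsP[xy Xxy] [z0 t0].
rewrite -(sum_link_edges x y (fun z => m [fset x; y; z]%fset)).
have sk : skeleton X 1 [fset x; y]%fset by split=> //; rewrite cardfs2 xy.
have co z : triangle x y z -> cofaces X 1 [fset x; y]%fset [fset x; y; z]%fset.
  move=> /and4P[_ xz yz /asboolP Xt]; split; last exact: fsubsetUl.
  split=> //; rewrite [(_ `|` [fset z])%fset]fsetUC cardfsU1 cardfs2 xy !inE.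
  by rewrite negb_or ![z == _]eq_sym xz yz.
rewrite /edge_weight (m_adm.2 1%N _ sk); last first.
  by exists [fset x; y; z0]%fset; exact: co.
symmetry; apply: (reindex_fsbig (fun z => [fset x; y; z]%fset)); split.
- by move=> z /= /link_edgeP; exact: co.
- move=> z z' /set_mem/link_edgeP/and4P[_ xz yz _] /set_mem/link_edgeP.
  move=> /and4P[_ xz' yz' _] E; apply/eqP.
  have : z \in [fset x; y; z']%fset by rewrite -E !inE eqxx orbT.
  by rewrite !inE ![z == _]eq_sym (negPf xz) (negPf yz) /= eq_sym.
- move=> t [[Xt t3] st].
  have : #|` (t `\` [fset x; y])%fset| == 1%N.
    by rewrite cardfsDS// t3 cardfs2 xy.
  move=> /cardfs1P[z tz].
  have tE : t = [fset x; y; z]%fset.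
    by rewrite -tz fsetUDl fsetDv fsetD0; apply/esym/fsetUidPr.
  exists z => //=; apply/link_edgeP.
  have : z \in (t `\` [fset x; y])%fset by rewrite tz inE.
  rewrite !inE negb_or => /andP[/andP[zx zy] _].
  by apply/and4P; split=> //; rewrite 1?eq_sym//; apply/asboolP; rewrite -tE.
Qed.

(** Admissibility says nothing about an edge that lies in no triangle. *)
Lemma sum_triangle_weight_le x y : y \in neighbors x ->
  \sum_(z <- neighbors x) triangle_weight x y z <= edge_weight x y.
Proof.
move=> yx; have [h|h] := pselect (exists z, triangle x y z).
  by rewrite sum_triangle_weight.
rewrite big1 ?(ltW (edge_weight_gt0 yx))// => z _.
by rewrite /triangle_weight ifF//; apply/negbTE/negP => t; apply: h; exists z.
Qed.

Lemma path_invariant (T : eqType) (f : V -> T) (e : rel V) x p :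
  (forall u v, e u v -> f u = f v) -> path e x p -> f (last x p) = f x.
Proof.
by move=> ef; elim: p x => //= y p IH x /andP[/ef -> /IH].
Qed.

Section LinkPoincare.
Variables (x : V) (mu : R).
Hypothesis link_conn : connected_complex (link X x).
Hypothesis mu_le : (mu%:E <= mu1 X m x)%E.

(** In a connected link with at least two vertices every edge at [x] lies in a
    triangle, so that the weights of the triangles add up to those of the edges;
    in a link with at most one vertex the left-hand side vanishes. *)
Lemma link_poincare (f : V -> R) :
  mu * (\sum_(y <- neighbors x) edge_weight x y * f y ^+ 2
        - (\sum_(y <- neighbors x) edge_weight x y * f y) ^+ 2 /
          \sum_(y <- neighbors x) edge_weight x y) <=
  2^-1 * \sum_(y <- neighbors x) \sum_(z <- neighbors x)
    triangle_weight x y z * (f y - f z) ^+ 2.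
Proof.
have rhs0 : 0 <= 2^-1 * \sum_(y <- neighbors x)
    \sum_(z <- neighbors x) triangle_weight x y z * (f y - f z) ^+ 2.
  rewrite mulr_ge0// sumr_ge0// => y _; rewrite sumr_ge0// => z _.
  by rewrite mulr_ge0 ?sqr_ge0// triangle_weight_ge0.
have [s1|s2] := leqP (size (neighbors x)) 1%N.
  apply: le_trans rhs0; rewrite le_eqVlt; apply/orP; left; apply/eqP.
  case E : (neighbors x) s1 => [|y [|//]] _.
    by rewrite !big_nil expr0n /= mul0r subr0 mulr0.
  rewrite !big_seq1; have : 0 < edge_weight x y.
    by apply: edge_weight_gt0; rewrite E mem_head.
  by move=> e0; field; rewrite gt_eqF.
pose n := size (neighbors x); pose v (i : 'I_n) := nth x (neighbors x) i.
have sumE (F : V -> R) : \sum_(y <- neighbors x) F y = \sum_(i < n) F (v i).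
  by rewrite (big_nth x) big_mkord.
have vn i : v i \in neighbors x by rewrite mem_nth.
have vnE y : y \in neighbors x -> exists i, v i = y.
  move=> yn; have lt : (index y (neighbors x) < n)%N by rewrite index_mem.
  by exists (Ordinal lt); rewrite /v nth_index.
have vinj i j : v i = v j -> i = j.
  by move=> /eqP; rewrite nth_uniq ?neighbors_uniq// => /eqP/val_inj.
have ex_tri i : exists z, triangle x (v i) z.
  have [j ji] : exists j, j != i.
    have n1 : (1 < n)%N by [].
    have n0 : (0 < n)%N by apply: ltnW.
    have [i0|i0] := eqVneq (val i) 0%N.
      by exists (Ordinal n1); rewrite -val_eqE /= i0.
    by exists (Ordinal n0); rewrite -val_eqE /= eq_sym.
  have /link_vertexP vi := vn i; have /link_vertexP vj := vn j.
  have [p pp lp] := link_conn vi vj.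
  case: p pp lp => [_ /= E|u p /= /andP[/asboolP/link_edgeP t _] _].
    by rewrite (vinj _ _ E) eqxx in ji.
  by exists u.
rewrite !sumE; under [X in _ <= 2^-1 * X]eq_bigr do rewrite sumE.
apply: (@poincare R n (fun i => edge_weight x (v i))
  (fun i j => triangle_weight x (v i) (v j)) _ _ _ _ mu _ _ (fun i => f (v i))).
- by move=> i; exact: edge_weight_gt0.
- by move=> i j; exact: triangle_weight_ge0.
- by move=> i j; exact: triangle_weightAC.
- by move=> i; rewrite -(sumE (triangle_weight x (v i))) sum_triangle_weight.
- move=> g gb i j.
  have /link_vertexP vi := vn i; have /link_vertexP vj := vn j.
  have [p pp lp] := link_conn vi vj.
  pose G u : option R := if [pick k | v k == u] is Some k then Some (g k) else None.
  have GE k : G (v k) = Some (g k).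
    by rewrite /G; case: pickP => [k' /eqP/vinj -> //|/(_ k)]; rewrite eqxx.
  have Ginv u w : `[< ordered_edge (link X x) u w >] -> G u = G w.
    move=> /asboolP/link_edgeP t; have [un wn _] := triangle_neighbors t.
    have [k uk] := vnE _ un; have [k' wk] := vnE _ wn; subst u w.
    rewrite !GE; congr Some; apply: gb; rewrite /triangle_weight t.
    by apply: m_adm.1; case/and4P: t => _ _ _ /asboolP.
  by have := path_invariant Ginv pp; rewrite lp !GE => -[].
- move=> l g l0 [i gi] eig.
  have : (mu1 X m x <= l%:E)%E.
    apply: ereal_inf_lbound; exists l => //; split=> //.
    pose G u : R := if [pick k | v k == u] is Some k then g k else 0.
    have GE k : G (v k) = g k.
      by rewrite /G; case: pickP => [k' /eqP/vinj -> //|/(_ k)]; rewrite eqxx.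
    exists G; split; first by exists (v i); [exact/link_vertexP | rewrite GE].
    move=> y /link_vertexP /vnE[k <-]; rewrite /link_laplacian sum_link_edges.
    rewrite sumE GE -eig; congr (_ - _); apply: eq_bigr => j _.
    by rewrite GE /triangle_weight; case: ifP => //; rewrite mul0r mul0r.
  by move=> /(le_trans mu_le); rewrite lee_fin.
Qed.

Lemma link_poincare_vector N (u : V -> 'rV[R]_N) :
  mu * (\sum_(y <- neighbors x) edge_weight x y * enorm (u y) ^+ 2
        - enorm (\sum_(y <- neighbors x) edge_weight x y *: u y) ^+ 2 /
          \sum_(y <- neighbors x) edge_weight x y) <=
  2^-1 * \sum_(y <- neighbors x) \sum_(z <- neighbors x)
    triangle_weight x y z * enorm (u y - u z) ^+ 2.
Proof.
set S := \sum_(y <- _) edge_weight x y.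
have -> : \sum_(y <- neighbors x) edge_weight x y * enorm (u y) ^+ 2 =
    \sum_i \sum_(y <- neighbors x) edge_weight x y * u y 0 i ^+ 2.
  by rewrite exchange_big /=; apply: eq_bigr => y _; rewrite enorm_sqr mulr_sumr.
rewrite enorm_sqr mulr_suml -sumrB mulr_sumr.
have -> : \sum_(y <- neighbors x) \sum_(z <- neighbors x)
    triangle_weight x y z * enorm (u y - u z) ^+ 2 =
  \sum_i \sum_(y <- neighbors x) \sum_(z <- neighbors x)
    triangle_weight x y z * (u y 0 i - u z 0 i) ^+ 2.
  rewrite [RHS]exchange_big /=; apply: eq_bigr => y _.
  rewrite [RHS]exchange_big /=; apply: eq_bigr => z _.
  by rewrite enorm_sqr mulr_sumr; apply: eq_bigr => i _; rewrite !mxE.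
rewrite mulr_sumr; apply: ler_sum => i _.
apply: le_trans (link_poincare (fun y => u y 0 i)).
rewrite le_eqVlt; apply/orP; left; apply/eqP.
congr (mu * (_ - _ ^+ 2 / _)); rewrite summxE.
by apply: eq_bigr => y _; rewrite mxE.
Qed.

(** The Poincare inequality of the link for maps to [Y]: the vector-valued
    inequality applied to almost centered realizations. *)
Theorem link_poincare_hadamard (Y : metricType R) (f : V -> Y) (b : Y) :
  hadamard Y -> flexible (@cone_dist R Y b) -> 0 <= mu ->
  (forall q, dispersion (neighbors x) (edge_weight x) f b
             <= dispersion (neighbors x) (edge_weight x) f q) ->
  mu * dispersion (neighbors x) (edge_weight x) f b <=
  2^-1 * \sum_(y <- neighbors x) \sum_(z <- neighbors x)
    triangle_weight x y z * mdist (f y) (f z) ^+ 2.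
Proof.
move=> had flex mu0 bmin; set S := \sum_(y <- neighbors x) edge_weight x y.
have S0 : 0 <= S.
  by rewrite /S big_seq sumr_ge0// => y yn; rewrite ltW// edge_weight_gt0.
apply/ler_addgt0Pr => e e0.
pose e' := e / (mu / S + 1).
have c0 : 0 <= mu / S by rewrite divr_ge0.
have e'0 : 0 < e' by rewrite divr_gt0//; lra.
have [N [u [un ud ue]]] := barycenter_realization had flex (neighbors_uniq x)
  (@edge_weight_gt0 x) bmin e'0.
have h1 : dispersion (neighbors x) (edge_weight x) f b =
    \sum_(y <- neighbors x) edge_weight x y * enorm (u y) ^+ 2.
  rewrite /dispersion !big_seq; apply: eq_bigr => y yn.
  by rewrite un// metric_sym.
have h2 : 2^-1 * \sum_(y <- neighbors x) \sum_(z <- neighbors x)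
      triangle_weight x y z * enorm (u y - u z) ^+ 2 <=
    2^-1 * \sum_(y <- neighbors x) \sum_(z <- neighbors x)
      triangle_weight x y z * mdist (f y) (f z) ^+ 2.
  rewrite ler_pM2l// big_seq [leRHS]big_seq; apply: ler_sum => y yn.
  rewrite big_seq [leRHS]big_seq; apply: ler_sum => z zn.
  by rewrite ler_wpM2l ?triangle_weight_ge0// ud.
have := link_poincare_vector u; rewrite -h1 -/S.
set M := enorm _ ^+ 2 in ue * => h3.
have : mu * (M / S) <= e.
  have -> : e = e' * (mu / S + 1) by rewrite /e' divfK//; lra.
  have -> : mu * (M / S) = M * (mu / S) by ring.
  have := ler_wpM2r c0 ue; lra.
by lra.
Qed.

End LinkPoincare.

End Links.

(** * Sums over a fundamental domain *)

Section WeightedAction.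
Variables (R : realType) (V : choiceType) (X : complex V) (m : {fset V} -> R).
Hypothesis X_lf : locally_finite X.
Variables (G : groupType) (act : G -> V -> V).
Hypothesis act_aut : acts_by_automorphisms X m act.
Hypothesis act_pd : properly_discontinuous X act.
Hypothesis act_cof : cofinite_action X act.
Implicit Types (x y z : V) (g h : G).
Local Notation neighbors := (neighbors X).
Local Notation triangle := (triangle X).
Local Notation edge_weight := (edge_weight m).
Local Notation triangle_weight := (triangle_weight X m).

Lemma act1 x : vertices X x -> act 1%g x = x.
Proof. by case: act_aut => + _ _; exact. Qed.

Lemma actM g h x : vertices X x -> act (g * h)%g x = act g (act h x).
Proof. by case: act_aut => _ + _; exact. Qed.

Lemma act_vertex g x : vertices X x -> vertices X (act g x).
Proof. by case: act_aut => _ _ /(_ g)[[vf _ _] _ _]; exact: vf. Qed.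

Lemma actVK g x : vertices X x -> act g^-1%g (act g x) = x.
Proof. by move=> vx; rewrite -actM// mulVg act1. Qed.

Lemma actKV g x : vertices X x -> act g (act g^-1%g x) = x.
Proof. by move=> vx; rewrite -actM// mulgV act1. Qed.

Lemma act_inj g x y : vertices X x -> vertices X y -> act g x = act g y -> x = y.
Proof. by move=> vx vy E; rewrite -(actVK g vx) E actVK. Qed.

Lemma act_eq g x y : vertices X x -> vertices X y -> (act g x == act g y) = (x == y).
Proof. by move=> vx vy; apply/eqP/eqP => [/act_inj->|->]. Qed.

Lemma act_edge g x y : ordered_edge X x y -> ordered_edge X (act g x) (act g y).
Proof.
move=> e; have [vx vy] := ordered_edge_vertices e; case: e => xy Xxy; split.
  by rewrite act_eq.
have [_ _ /(_ g)[_ + _]] := act_aut => /(_ [fset x; y]%fset)[|_].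
  by move=> v; rewrite !inE => /orP[] /eqP ->.
by rewrite imfset_fset2; exact.
Qed.

Lemma act_neighbors g x y : vertices X x -> vertices X y ->
  (act g y \in neighbors (act g x)) = (y \in neighbors x).
Proof.
move=> vx vy; apply/neighborsP/neighborsP => //; last exact: act_edge.
by move=> /(act_edge g^-1%g); rewrite !actVK.
Qed.

Lemma neighbor_vertex x y : y \in neighbors x -> vertices X x /\ vertices X y.
Proof. by move=> /neighborsP => /(_ X_lf)/ordered_edge_vertices. Qed.

Lemma perm_neighbors g x : vertices X x ->
  perm_eq (neighbors (act g x)) [seq act g y | y <- neighbors x].
Proof.
move=> vx; apply: uniq_perm; first exact: neighbors_uniq.
  rewrite map_inj_in_uniq ?neighbors_uniq// => y z.
  by move=> /neighbor_vertex[_ vy] /neighbor_vertex[_ vz]; exact: act_inj.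
move=> y; apply/idP/mapP => [yn|[z zn ->]].
  have [_ vy] := neighbor_vertex yn.
  exists (act g^-1%g y); last by rewrite actKV.
  by rewrite -(actVK g vx) act_neighbors//; exact: act_vertex.
by rewrite act_neighbors//; have [] := neighbor_vertex zn.
Qed.

Lemma sum_neighbors g x (F : V -> R) : vertices X x ->
  \sum_(y <- neighbors (act g x)) F y = \sum_(y <- neighbors x) F (act g y).
Proof. by move=> vx; rewrite (perm_big _ (perm_neighbors g vx)) big_map. Qed.

Lemma act_edge_weight g x y : y \in neighbors x ->
  edge_weight (act g x) (act g y) = edge_weight x y.
Proof.
move=> /neighborsP => /(_ X_lf)[_ Xxy]; rewrite /edge_weight -imfset_fset2.
by case: act_aut => _ _ /(_ g)[_ _]; exact.
Qed.

Lemma act_triangle_weight g x y z : vertices X x -> vertices X y -> vertices X z ->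
  triangle_weight (act g x) (act g y) (act g z) = triangle_weight x y z.
Proof.
move=> vx vy vz; have [_ _ /(_ g)[_ sim inv]] := act_aut.
have E : [fset act g x; act g y; act g z]%fset = (act g @` [fset x; y; z])%fset.
  by rewrite imfsetU imfset_fset2 imfset_fset1.
have [|v v'] := sim [fset x; y; z]%fset.
  by move=> u; rewrite !inE => /orP[/orP[]|] /eqP ->.
rewrite /triangle_weight /triangle !act_eq// E.
have -> : `[< X (act g @` [fset x; y; z])%fset >] = `[< X [fset x; y; z]%fset >].
  by apply/asboolP/asboolP.
by case: ifP => // /and4P[_ _ _ /asboolP] /inv.
Qed.

Lemma vertex_representatives : exists D : seq V,
  [/\ uniq D, forall x, x \in D -> vertices X x &
      forall x, vertices X x -> exists g, act g x \in D].
Proof.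
pose S := skeleton X 0; pose O := [set orbit_of act s | s in S].
have finO : finite_set O by exact: act_cof.
have : forall o : set {fset V}, exists s, O o -> S s /\ orbit_of act s = o.
  move=> o; have [[s Ss so]|nO] := pselect (O o); first by exists s.
  by exists fset0.
move=> /choice[r rP]; pose A := \bigcup_(s in r @` O) [set` s].
have finA : finite_set A.
  by apply: bigcup_finite => [|s _]; [exact: finite_image | exact: finite_fset].
exists (fset_set A); split=> [|x|x vx]; first exact: fset_uniq.
  rewrite in_fset_set ?inE//= => -[s [w Oo so] xs].
  rewrite -so /= in xs; have [[Xs _] _] := rP _ Oo.
  apply: (simplices_sub Xs); first by rewrite fsub1set.
  by apply/fset0Pn; exists x; rewrite inE.
have Sx : S [fset x]%fset by split=> //; rewrite cardfs1.
have Oo : O (orbit_of act [fset x]%fset) by exists [fset x]%fset.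
have [[_ _] so] := rP _ Oo.
have [g _ gr] : orbit_of act [fset x]%fset (r (orbit_of act [fset x]%fset)).
  rewrite -[X in X _]so; exists 1%g => //.
  have [[Xs _] _] := rP _ Oo; apply/fsetP => v; apply/imfsetP/idP => /=.
    move=> [w ws ->]; rewrite act1//; apply: (simplices_sub Xs).
      by rewrite fsub1set.
    by apply/fset0Pn; exists w; rewrite inE.
  move=> vs; exists v => //; rewrite act1//; apply: (simplices_sub Xs).
    by rewrite fsub1set.
  by apply/fset0Pn; exists v; rewrite inE.
exists g; rewrite in_fset_set// inE; exists (r (orbit_of act [fset x]%fset)).
  by exists (orbit_of act [fset x]%fset).
by rewrite /= -gr imfset_fset1 inE.
Qed.

Lemma finite_returns (K : seq V) : (forall x, x \in K -> vertices X x) ->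
  finite_set [set g | exists2 x, x \in K & act g x \in K].
Proof.
move=> Kv; pose K' : set {fset V} := (fun x => [fset x]%fset) @` [set` K].
have fK' : finite_set K' by exact/finite_image/finite_seq.
have sK' : K' `<=` simplices X by move=> _ [x /= /Kv vx <-].
apply: sub_finite_set (act_pd fK' sK') => g /= [x xK gxK].
exists [fset x]%fset; first by exists x.
by rewrite imfset_fset1; exists (act g x).
Qed.

Variable D : seq V.
Hypothesis D_uniq : uniq D.
Hypothesis D_vertices : forall x, x \in D -> vertices X x.
Hypothesis D_orbits : forall x, vertices X x -> exists g, act g x \in D.

Definition visits x : set G := [set g | act g x \in D].

Lemma finite_visits x : vertices X x -> finite_set (visits x).
Proof.
move=> vx; have Kv y : y \in x :: D -> vertices X y.
  by rewrite inE => /predU1P[->|/D_vertices].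
apply: sub_finite_set (finite_returns Kv) => g gx; exists x; first exact: mem_head.
by rewrite inE gx orbT.
Qed.

(** As a sum over the group, it is invariant by a change of variables. *)
Definition visit_count x : R := \sum_(g \in [set: G]) ((act g x \in D)%:R : R).

Lemma visit_countE x : vertices X x -> visit_count x = \sum_(g \in visits x) (1 : R).
Proof.
move=> vx; rewrite /visit_count; symmetry.
have -> : \sum_(g \in visits x) (1 : R) =
          \sum_(g \in visits x) ((act g x \in D)%:R : R).
  by apply: eq_fsbigr => g; rewrite inE /visits /= => ->.
apply: fsbig_widen => // g [_] /=; rewrite /visits /= => /negP/negPf -> //.
Qed.

Lemma visit_count_gt0 x : vertices X x -> 0 < visit_count x.
Proof.
move=> vx; rewrite visit_countE// fsbig_finite /=; last exact: finite_visits.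
have [g gx] := D_orbits vx.
rewrite (big_fsetD1 g) /=; last by rewrite in_fset_set ?inE//; exact: finite_visits.
by apply: ltr_pwDl => //; exact: sumr_ge0.
Qed.

Lemma act_visit_count h x : vertices X x -> visit_count (act h x) = visit_count x.
Proof.
move=> vx; rewrite /visit_count.
rewrite [RHS](@reindex_fsbig _ _ _ _ _ (fun g => (g * h)%g) [set: G] [set: G]).
  by apply: eq_fsbigr => g _; rewrite actM.
split=> // [g g' _ _ /mulIg//|g _]; exists (g * h^-1)%g => //.
by rewrite mulgVK.
Qed.

(** This weight plays the role of the inverse orders of the stabilizers in a
    fundamental domain: its translates sum up to one. *)
Definition orbit_weight x : R := if x \in D then (visit_count x)^-1 else 0.

Lemma orbit_weight_ge0 x : 0 <= orbit_weight x.
Proof.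
rewrite /orbit_weight; case: ifP => // /D_vertices vx.
by rewrite invr_ge0 ltW// visit_count_gt0.
Qed.

Lemma orbit_weight_gt0 x : x \in D -> 0 < orbit_weight x.
Proof.
by move=> xD; rewrite /orbit_weight xD invr_gt0; exact/visit_count_gt0/D_vertices.
Qed.

Lemma sum_orbit_weight x : vertices X x ->
  \sum_(g \in [set: G]) orbit_weight (act g x) = 1.
Proof.
move=> vx; rewrite -[RHS](mulVf (lt0r_neq0 (visit_count_gt0 vx))) mulr_fsumr.
apply: eq_fsbigr => g _; rewrite /orbit_weight act_visit_count//.
by case: ifP => _; rewrite ?mulr1 ?mulr0.
Qed.

(** For an invariant [F], a sum over the oriented edges modulo the action. *)
Definition orbit_sum (F : V -> V -> R) : R :=
  \sum_(x <- D) orbit_weight x * \sum_(y <- neighbors x) F x y.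

(* [K] and [returns] are finite and contain the vertices and the group elements
   that contribute to the sums over triples. *)
Let K : seq V := undup (D ++ flatten [seq neighbors x | x <- D]).
Let returns := [set g | exists2 x, x \in K & act g x \in K].

Let K_vertices x : x \in K -> vertices X x.
Proof.
rewrite mem_undup mem_cat => /orP[/D_vertices//|/flattenP[s /mapP[z zD ->]]].
by move=> /neighbor_vertex[].
Qed.

Let DK x : x \in D -> x \in K.
Proof. by move=> xD; rewrite mem_undup mem_cat xD. Qed.

Let NK x y : x \in D -> y \in neighbors x -> y \in K.
Proof.
move=> xD yx; rewrite mem_undup mem_cat; apply/orP; right; apply/flattenP.
by exists (neighbors x) => //; exact: map_f.
Qed.

Let edges3 : set (V * V * G) := [set p | ordered_edge X p.1.1 p.1.2].

Let restrict (F : V -> V -> R) x y := if y \in neighbors x then F x y else 0.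

Let sum_returns y : y \in K -> \sum_(g \in returns) orbit_weight (act g y) = 1.
Proof.
move=> yK; rewrite -(sum_orbit_weight (K_vertices yK)).
apply: fsbig_widen => // g [_ /= out]; rewrite /orbit_weight; case: ifP => // gyD.
by exfalso; apply: out; exists y => //; exact: DK.
Qed.

Let orbit_sum_triples (F : V -> V -> R) : orbit_sum F =
  \sum_(p \in ([set` K] `*` [set` K]) `*` returns)
   orbit_weight p.1.1 * orbit_weight (act p.2 p.1.2) * restrict F p.1.1 p.1.2.
Proof.
have finK : finite_set [set` K] by exact: finite_seq.
have finr : finite_set returns by exact: (finite_returns K_vertices).
rewrite -(@pair_fsbig _ _ _ _ _ _ _ (fun p g =>
  orbit_weight p.1 * orbit_weight (act g p.2) * restrict F p.1 p.2))//; last first.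
  exact: finite_setX.
rewrite -(@pair_fsbig _ _ _ _ _ _ _ (fun x y => \sum_(g \in returns)
  orbit_weight x * orbit_weight (act g y) * restrict F x y))//.
rewrite /orbit_sum (fsbig_seq _ _ D_uniq).
rewrite (@fsbig_widen _ _ _ _ [set` D] [set` K]); first last.
- by move=> x [_ /= /negP/negPf xD]; rewrite /orbit_weight xD mul0r.
- by move=> x /=; exact: DK.
apply: eq_fsbigr => x /set_mem /= xK.
transitivity (\sum_(y \in [set` K]) orbit_weight x * restrict F x y); last first.
  apply: eq_fsbigr => y /set_mem /= yK.
  transitivity (\sum_(g \in returns)
      (orbit_weight x * restrict F x y) * orbit_weight (act g y)).
    by rewrite -mulr_fsumr sum_returns// mulr1.
  by apply: eq_fsbigr => g _; ring.
rewrite -mulr_fsumr; have [xD|xD] := boolP (x \in D); last first.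
  by rewrite /orbit_weight (negPf xD) !mul0r.
congr (_ * _); rewrite fsbig_seq ?neighbors_uniq//.
transitivity (\sum_(y \in [set` neighbors x]) restrict F x y).
  by apply: eq_fsbigr => y /set_mem /= yx; rewrite /restrict yx.
apply: fsbig_widen; first by move=> y /=; exact: NK.
by move=> y [_ /= /negP/negPf yx]; rewrite /restrict yx.
Qed.

Let orbit_sumE (F : V -> V -> R) : orbit_sum F =
  \sum_(p \in edges3)
    orbit_weight p.1.1 * orbit_weight (act p.2 p.1.2) * F p.1.1 p.1.2.
Proof.
rewrite orbit_sum_triples (@fsbig_widen _ _ _ _ _ [set: V * V * G])//; last first.
  move=> [[x y] g] /= [_ out]; rewrite /restrict; case: ifP => yx; rewrite ?mulr0//.
  rewrite /orbit_weight; case: ifP => [xD|_]; last by rewrite !mul0r.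
  case: ifP => [gyD|_]; last by rewrite mulr0 mul0r.
  exfalso; apply: out; have yK := NK xD yx; split=> /=.
    by split=> //=; exact: DK.
  by exists y => //; exact: DK.
rewrite -(@fsbig_widen _ _ _ _ edges3 [set: V * V * G])//.
  apply: eq_fsbigr => -[[x y] g] /set_mem; rewrite /edges3 /= => xy.
  by rewrite /restrict ifT//; apply/neighborsP.
move=> [[x y] g] /= [_ out]; rewrite /restrict ifF ?mulr0//.
by apply/negbTE/negP => /neighborsP => /(_ X_lf).
Qed.

(** Mass transport. As the translates of the weight add up to one, both sides
    are sums over triples [(x, y, g)] with the weights of [x] and [g y]; the
    involution that maps [(x, y, g)] to [(g y, g x, g^-1)] exchanges them. *)
Lemma orbit_sum_sym (F : V -> V -> R) :
  (forall g x y, ordered_edge X x y -> F (act g x) (act g y) = F x y) ->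
  orbit_sum F = orbit_sum (fun x y => F y x).
Proof.
move=> Finv; rewrite !orbit_sumE.
pose h (p : V * V * G) := (act p.2 p.1.2, act p.2 p.1.1, p.2^-1%g).
have hh p : edges3 p -> edges3 (h p) /\ h (h p) = p.
  case: p => -[x y] g /=; rewrite /edges3 /= => xy.
  have [vx vy] := ordered_edge_vertices xy; split.
    exact/act_edge/ordered_edge_sym.
  by rewrite /h /= !actVK// invgK.
rewrite (@reindex_fsbig _ _ _ _ _ h edges3 edges3).
  apply: eq_fsbigr => -[[x y] g] /set_mem; rewrite /edges3 /= => xy.
  have [vx vy] := ordered_edge_vertices xy.
  by rewrite actVK// Finv ?[orbit_weight x * _]mulrC//; exact: ordered_edge_sym.
split=> [p /hh[]//|p q /set_mem/hh[_ p2] /set_mem/hh[_ q2] E|p /hh[hp hhp]].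
  by rewrite -p2 E q2.
by exists (h p).
Qed.

End WeightedAction.

(** * The averaging flow *)

Section OrbitSums.
Variables (R : realType) (V : choiceType) (X : complex V).
Variables (G : groupType) (act : G -> V -> V) (D : seq V).
Hypothesis w_ge0 : forall x, 0 <= orbit_weight R act D x.
Implicit Types F H : V -> V -> R.
Local Notation orbit_sum := (orbit_sum X act D).
Local Notation neighbors := (neighbors X).

Lemma orbit_sum_le F H :
  (forall x y, x \in D -> y \in neighbors x -> F x y <= H x y) ->
  orbit_sum F <= orbit_sum H.
Proof.
move=> FH; rewrite /orbit_sum big_seq [leRHS]big_seq; apply: ler_sum => x xD.
rewrite ler_wpM2l// big_seq [leRHS]big_seq; apply: ler_sum => y yx.
exact: FH.
Qed.

Lemma orbit_sum_lin (a b : R) F H :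
  orbit_sum (fun x y => a * F x y + b * H x y) = a * orbit_sum F + b * orbit_sum H.
Proof.
rewrite /orbit_sum !mulr_sumr -big_split /=; apply: eq_bigr => x _.
by rewrite big_split /= -!mulr_sumr; ring.
Qed.

Lemma orbit_sum_ge0 F : (forall x y, x \in D -> y \in neighbors x -> 0 <= F x y) ->
  0 <= orbit_sum F.
Proof.
move=> F0; rewrite /orbit_sum big_seq sumr_ge0// => x xD.
by rewrite mulr_ge0// big_seq sumr_ge0// => y yx; exact: F0.
Qed.

Lemma orbit_sum_term F x y : uniq D ->
  (forall x y, x \in D -> y \in neighbors x -> 0 <= F x y) ->
  x \in D -> y \in neighbors x -> orbit_weight R act D x * F x y <= orbit_sum F.
Proof.
move=> uD F0 xD yx; rewrite /orbit_sum (big_rem x)//= (big_rem y)//= mulrDr.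
rewrite -addrA lerDl addr_ge0//.
  by rewrite mulr_ge0// big_seq sumr_ge0// => z /mem_rem zx; exact: F0.
rewrite big_seq sumr_ge0// => z /mem_rem zD.
by rewrite mulr_ge0// big_seq sumr_ge0// => u uz; exact: F0.
Qed.

End OrbitSums.

Section Averaging.
Variables (R : realType) (V : choiceType) (X : complex V) (m : {fset V} -> R).
Hypothesis X_lf : locally_finite X.
Hypothesis m_adm : admissible_weight X m.
Hypothesis links_connected : forall x, vertices X x -> connected_complex (link X x).
Variables (G : groupType) (act : G -> V -> V).
Hypothesis act_aut : acts_by_automorphisms X m act.
Hypothesis act_pd : properly_discontinuous X act.
Variable D : seq V.
Hypothesis D_uniq : uniq D.
Hypothesis D_vertices : forall x, x \in D -> vertices X x.
Hypothesis D_orbits : forall x, vertices X x -> exists g, act g x \in D.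
Variables (mu : R).
Hypothesis mu_gt : 2^-1 < mu.
Hypothesis mu_le : forall x, x \in D -> (mu%:E <= mu1 X m x)%E.
Variables (Y : metricType R).
Hypothesis had : hadamard Y.
Hypothesis flex : forall p : Y, flexible (@cone_dist R Y p).
Variable rho : {multiplicative G -> self_isometry Y}.
Implicit Types (f : V -> Y) (x y z : V) (g : G).
Local Notation d := mdist.
Local Notation neighbors := (neighbors X).
Local Notation edge_weight := (edge_weight m).
Local Notation triangle_weight := (triangle_weight X m).
Local Notation orbit_sum := (orbit_sum X act D).
Local Notation orbit_sum_sym := (orbit_sum_sym X_lf act_aut act_pd D_uniq
  D_vertices D_orbits).

Let w_ge0 x : 0 <= orbit_weight R act D x.
Proof. exact: (orbit_weight_ge0 R act_pd D_vertices D_orbits). Qed.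

Definition equivariant f : Prop :=
  forall g x, vertices X x -> f (act g x) = rho g (f x).

Definition energy f f' : R :=
  orbit_sum (fun x y => edge_weight x y * d (f x) (f' y) ^+ 2).

Lemma equivariant_dist f f' g x y : equivariant f -> equivariant f' ->
  vertices X x -> vertices X y ->
  d (f (act g x)) (f' (act g y)) = d (f x) (f' y).
Proof. by move=> ef ef' vx vy; rewrite ef// ef'// isometry_dist. Qed.

Lemma energy_sym f f' : equivariant f -> equivariant f' -> energy f f' = energy f' f.
Proof.
move=> ef ef'; rewrite /energy orbit_sum_sym.
  by congr (orbit_sum _); apply/funext => x; apply/funext => y;
    rewrite edge_weightC metric_sym.
move=> g x y xy; have [vx vy] := ordered_edge_vertices xy.
by rewrite equivariant_dist// (act_edge_weight X_lf act_aut)//; apply/neighborsP.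
Qed.

Lemma weighted_sqr_ge0 (p q : V -> V -> Y) x y : y \in neighbors x ->
  0 <= edge_weight x y * d (p x y) (q x y) ^+ 2.
Proof.
move=> yx; rewrite mulr_ge0 ?sqr_ge0// ltW//; exact: (edge_weight_gt0 X_lf m_adm).
Qed.

Lemma energy_ge0 f f' : 0 <= energy f f'.
Proof.
apply: orbit_sum_ge0 => // x y _.
exact: (weighted_sqr_ge0 (fun x _ => f x) (fun _ y => f' y)).
Qed.

(** At an isolated vertex every point minimizes the empty sum; keeping the value
    of [f] there makes the averages of equivariant maps equivariant. *)
Definition is_average f f' : Prop := forall x,
  (neighbors x = [::] -> f' x = f x) /\
  forall q, dispersion (neighbors x) (edge_weight x) f (f' x) <=
            dispersion (neighbors x) (edge_weight x) f q.

Let sum_edge_weight_gt0 x : neighbors x <> [::] ->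
  0 < \sum_(y <- neighbors x) edge_weight x y.
Proof.
have := @edge_weight_gt0 _ _ _ _ X_lf m_adm x.
case: (neighbors x) => // y s ew0 _; rewrite big_cons ltr_pwDl ?ew0 ?mem_head//.
by rewrite big_seq sumr_ge0// => z zs; rewrite ltW// ew0// inE zs orbT.
Qed.

Let edge_weight_ge0 x y : y \in neighbors x -> 0 <= edge_weight x y.
Proof. by move=> yx; exact/ltW/(edge_weight_gt0 X_lf m_adm). Qed.

Lemma exists_average f : exists f', is_average f f'.
Proof.
have : forall x, exists b, (neighbors x = [::] -> b = f x) /\
  forall q, dispersion (neighbors x) (edge_weight x) f b <=
            dispersion (neighbors x) (edge_weight x) f q.
  move=> x; have [n0|n0] := pselect (neighbors x = [::]).
    by exists (f x); rewrite n0 /dispersion; split=> // q; rewrite !big_nil.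
  have [b bP] := dispersion_min f (@edge_weight_ge0 x) had
    (sum_edge_weight_gt0 n0).
  by exists b.
by move=> /choice[f' f'P]; exists f'.
Qed.

(** Minimizers are unique and isometries preserve the dispersion. *)
Lemma average_equivariant f f' : equivariant f -> is_average f f' -> equivariant f'.
Proof.
move=> ef av g x vx; have [n0|n0] := pselect (neighbors x = [::]).
  have gn0 : neighbors (act g x) = [::].
    have := perm_neighbors X_lf act_aut g vx; rewrite n0 /= => /perm_size.
    exact: size0nil.
  by rewrite (av _).1// ef// (av x).1.
have E q : dispersion (neighbors (act g x)) (edge_weight (act g x)) f (rho g q) =
    dispersion (neighbors x) (edge_weight x) f q.
  rewrite /dispersion (sum_neighbors X_lf act_aut)// !big_seq.
  apply: eq_bigr => y yx; have [_ vy] := neighbor_vertex X_lf yx.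
  by rewrite (act_edge_weight X_lf act_aut)// ef// isometry_dist.
have [q qE] := isometry_surj (rho g) (f' (act g x)).
rewrite -qE; congr (rho g _).
have [_ _ cat] := had.
apply: (dispersion_min_uniq (v := f) (@edge_weight_ge0 x) cat
  (sum_edge_weight_gt0 n0)); last exact: (av x).2.
by move=> r; rewrite -E qE -E; exact: (av _).2.
Qed.

(** Garland's argument: the Poincare inequalities of the links are summed over
    the vertices, and every edge is counted with the weights of the triangles
    around it, which add up to at most its own weight. *)
Lemma energy_average f f' : equivariant f -> is_average f f' ->
  2 * mu * energy f' f <= energy f f.
Proof.
move=> ef av; have mu0 : 0 <= mu by apply: ltW; apply: lt_trans mu_gt.
pose F x y : R :=
  \sum_(z <- neighbors x) triangle_weight x y z * d (f y) (f z) ^+ 2.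
have le1 : mu * energy f' f <= 2^-1 * orbit_sum F.
  rewrite /energy /orbit_sum !mulr_sumr big_seq [leRHS]big_seq.
  apply: ler_sum => x xD; rewrite mulrCA [leRHS]mulrCA ler_wpM2l//.
  have vx := D_vertices xD.
  have := link_poincare_hadamard X_lf m_adm (links_connected vx) (mu_le xD) had
    (flex _) mu0 (av x).2.
  rewrite /dispersion; under eq_bigr do rewrite metric_sym.
  exact.
have Finv g x y : ordered_edge X x y -> F (act g x) (act g y) = F x y.
  move=> xy; have [vx vy] := ordered_edge_vertices xy.
  rewrite /F (sum_neighbors X_lf act_aut)// !big_seq; apply: eq_bigr => z zx.
  have [_ vz] := neighbor_vertex X_lf zx.
  by rewrite (act_triangle_weight act_aut)// equivariant_dist.
have le2 : orbit_sum F <= energy f f.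
  rewrite (orbit_sum_sym Finv) /energy /orbit_sum big_seq [leRHS]big_seq.
  apply: ler_sum => x xD; rewrite ler_wpM2l//.
  have -> : \sum_(y <- neighbors x) F y x =
      \sum_(y <- neighbors x) \sum_(z <- neighbors x)
        triangle_weight x z y * d (f x) (f z) ^+ 2.
    rewrite !big_seq; apply: eq_bigr => y yx.
    have E s : uniq s -> (forall z, triangle X x z y -> z \in s) ->
        \sum_(z <- s) triangle_weight x z y * d (f x) (f z) ^+ 2 =
        \sum_(z \in [set: V]) triangle_weight x z y * d (f x) (f z) ^+ 2.
      move=> us supp; rewrite fsbig_seq//; apply: fsbig_widen => // z [_ /= zs].
      rewrite /triangle_weight ifF ?mul0r//.
      by apply/negbTE/negP => /supp.
    rewrite (E (neighbors x)); [|exact: neighbors_uniq|]; last first.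
      by move=> z t; have [] := triangle_neighbors X_lf t.
    rewrite -(E (neighbors y)); [|exact: neighbors_uniq|]; last first.
      move=> z t; have [_ _] := triangle_neighbors X_lf t.
      by rewrite (neighbors_sym X_lf).
    rewrite /F; apply: eq_bigr => z _.
    by rewrite triangle_weightCA triangle_weightAC.
  rewrite exchange_big /= big_seq [leRHS]big_seq; apply: ler_sum => z zx.
  by rewrite -mulr_suml ler_wpM2r ?sqr_ge0// (sum_triangle_weight_le X_lf m_adm).
by lra.
Qed.

Definition kappa : R := (2 * mu)^-1.

(** A step of size [e] multiplies the energy by at most
    [1 - 2 * e * (1 - kappa) + 8 * e ^+ 2]; this is the value at the best choice
    [e = (1 - kappa) / 8]. *)
Definition rate : R := 1 - (1 - kappa) ^+ 2 / 8.

Lemma kappa_itv : 0 < kappa < 1.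
Proof.
have mu2 : 1 < 2 * mu by have := mu_gt; lra.
by rewrite invr_gt0 (lt_trans ltr01 mu2)/= invf_lt1 ?(lt_trans ltr01 mu2).
Qed.

Lemma rate_itv : 0 < rate < 1.
Proof. by have /andP[k0 k1] := kappa_itv; rewrite /rate; apply/andP; split; nra. Qed.

(** One step of the flow moves every value a small part of the way towards the
    average of the neighboring values. The decrease of the energy is of first
    order in the step size, the error of second order. The displacement bound
    makes the iterates converge. *)
Lemma flow_step f : equivariant f -> exists f1, [/\ equivariant f1,
  energy f1 f1 <= rate * energy f f &
  forall x y, x \in D -> y \in neighbors x ->
    orbit_weight R act D x * (edge_weight x y * d (f x) (f1 x) ^+ 2) <=
    4 * energy f f].
Proof.
move=> ef; have [f' av] := exists_average f.
have ef' := average_equivariant ef av; have [_ _ cat] := had.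
have /andP[k0 k1] := kappa_itv.
pose e : R := (1 - kappa) / 8.
have e01 : 0 <= e <= 1 by rewrite /e; apply/andP; split; lra.
have : forall x, exists q : Y, divides e (f x) (f' x) q.
  by move=> x; exact: CAT0_divides.
move=> /choice[f1 f1P].
have ef1 : equivariant f1.
  move=> g x vx; apply: (divides_uniq e01 (f1P (act g x))) => r.
  have [r' <-] := isometry_surj (rho g) r.
  by rewrite ef// ef'// !isometry_dist; exact: f1P.
set A := energy f f; set B := energy f' f.
have A0 : 0 <= A by exact: energy_ge0.
have B0 : 0 <= B by exact: energy_ge0.
have Bsym : energy f f' = B by exact: energy_sym.
have BA : B <= kappa * A.
  have mu0 : 0 < 2 * mu by have := mu_gt; lra.
  by rewrite /kappa -ler_pdivrMl ?invr_gt0// invrK; exact: energy_average.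
have ew x y : y \in neighbors x -> 0 <= edge_weight x y by exact: edge_weight_ge0.
(* the triangle inequality along [f' x], [f y], [f x], [f' y] *)
have C9 : energy f' f' <= 3 * (2 * B + A).
  have : energy f' f' <= orbit_sum (fun x y =>
       3 * (edge_weight x y * d (f' x) (f y) ^+ 2)
     + 3 * (1 * (edge_weight x y * d (f x) (f y) ^+ 2)
           + 1 * (edge_weight x y * d (f x) (f' y) ^+ 2))).
    apply: orbit_sum_le => // x y xD yx; have wxy := ew _ _ yx.
    have t1 := metric_triangle (f' x) (f y) (f' y).
    have t2 := metric_triangle (f y) (f x) (f' y).
    have n1 := mdist_ge0 (f' x) (f' y).
    rewrite [d (f y) (f x)]metric_sym in t2.
    have : d (f' x) (f' y) ^+ 2 <= 3 * (d (f' x) (f y) ^+ 2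
        + (d (f x) (f y) ^+ 2 + d (f x) (f' y) ^+ 2)).
      have : d (f' x) (f' y) <=
          d (f' x) (f y) + d (f x) (f y) + d (f x) (f' y) by lra.
      move: (d (f' x) (f' y)) (d (f' x) (f y)) (d (f x) (f y)) (d (f x) (f' y)) n1.
      move=> s a b c s0 le; have : s ^+ 2 <= (a + b + c) ^+ 2 by nra.
      have := sqr_ge0 (a - b); have := sqr_ge0 (b - c); have := sqr_ge0 (a - c).
      by lra.
    by move=> /(ler_wpM2l wxy); lra.
  rewrite !orbit_sum_lin -/(energy f' f) -/(energy f f) -/(energy f f') Bsym.
  by rewrite -/A -/B; lra.
exists f1; split=> // [|x y xD yx].
- have : energy f1 f1 <= orbit_sum (fun x y =>
      (1 - e) ^+ 2 * (edge_weight x y * d (f x) (f y) ^+ 2)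
      + 1 * (e * (1 - e) * (1 * (edge_weight x y * d (f x) (f' y) ^+ 2)
                      + 1 * (edge_weight x y * d (f' x) (f y) ^+ 2))
        + e ^+ 2 * (edge_weight x y * d (f' x) (f' y) ^+ 2))).
    apply: orbit_sum_le => // x y xD yx; have wxy := ew _ _ yx.
    have := divides_quadrilateral e01 (f1P x) (f1P y).
    by move=> /(ler_wpM2l wxy); lra.
  rewrite !orbit_sum_lin -!/(energy _ _) Bsym -/A -/B.
  move=> /le_trans; apply.
  have /andP[e0 e1] := e01.
  have h1 : e * (1 - e) * B <= e * (1 - e) * (kappa * A).
    by rewrite ler_wpM2l// mulr_ge0//; lra.
  have h2 : e ^+ 2 * energy f' f' <= e ^+ 2 * (3 * (2 * (kappa * A) + A)).
    by rewrite ler_wpM2l ?sqr_ge0//; lra.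
  have -> : rate * A = A - 2 * (e * (1 - kappa) * A) + 8 * (e ^+ 2 * A).
    by rewrite /rate /e; field.
  have h3 : 0 <= e ^+ 2 * A * (1 - kappa) by rewrite !mulr_ge0 ?sqr_ge0//; lra.
  by lra.
- have : orbit_weight R act D x * (edge_weight x y * d (f x) (f1 x) ^+ 2) <=
    orbit_weight R act D x * (2 * (edge_weight x y * d (f x) (f y) ^+ 2)
        + 2 * (edge_weight x y * d (f' x) (f y) ^+ 2)).
    rewrite ler_wpM2l//; have wxy := ew _ _ yx.
    have h := dist_divides e01 (f1P x).
    have t := metric_triangle (f x) (f y) (f' x).
    rewrite [d (f y) (f' x)]metric_sym in t.
    have n1 := mdist_ge0 (f x) (f' x).
    have : d (f x) (f1 x) ^+ 2 <= 2 * d (f x) (f y) ^+ 2 + 2 * d (f' x) (f y) ^+ 2.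
      apply: (le_trans h).
      move: (d (f x) (f' x)) (d (f x) (f y)) (d (f' x) (f y)) n1 t.
      move=> s a b s0 le; have : s ^+ 2 <= (a + b) ^+ 2 by nra.
      have := sqr_ge0 (a - b); have := sqr_ge0 s; have /andP[e0 e1] := e01.
      have e2 : e ^+ 2 <= 1 by nra.
      by move=> s2; have := ler_wpM2r s2 e2; lra.
    by move=> /(ler_wpM2l wxy); lra.
  move=> /le_trans; apply.
  have := @orbit_sum_term _ _ _ _ _ _ w_ge0 (fun x y =>
    2 * (edge_weight x y * d (f x) (f y) ^+ 2)
    + 2 * (edge_weight x y * d (f' x) (f y) ^+ 2)) x y D_uniq _ xD yx.
  rewrite orbit_sum_lin -!/(energy _ _) -/A -/B => le.
  apply: (le_trans (le _)); last by nra.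
  move=> x' y' _ yx'; rewrite addr_ge0// mulr_ge0//.
    exact: (weighted_sqr_ge0 (fun x _ => f x) (fun _ y => f y)).
  exact: (weighted_sqr_ge0 (fun x _ => f' x) (fun _ y => f y)).
Qed.

End Averaging.

(** * Convergence of the flow *)

Section GeometricDecay.
Variables (R : realType) (Y : metricType R).
Local Notation d := mdist.

Lemma expr_small (r M e : R) : 0 <= r < 1 -> 0 <= M -> 0 < e ->
  exists N, forall n, (N <= n)%N -> M * r ^+ n < e.
Proof.
move=> /andP[r0 r1] M0 e0.
have e'0 : 0 < e / (M + 1) by rewrite divr_gt0//; lra.
have : (r ^+ n @[n --> \oo] --> (0 : R)) by apply: cvg_expr; rewrite ger0_norm.
move=> /cvgrPdist_lt /(_ _ e'0) [N _ HN]; exists N => n Nn.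
have := HN n Nn; rewrite /= sub0r normrN ger0_norm ?exprn_ge0// => lt.
have rn0 : 0 <= r ^+ n by exact: exprn_ge0.
have : r ^+ n * (M + 1) < e by rewrite -ltr_pdivlMr//; lra.
by nra.
Qed.

Lemma geometric_limit (u : nat -> Y) (L r : R) : complete_space Y ->
  0 <= r < 1 -> 0 <= L -> (forall n, d (u n) (u n.+1) <= L * r ^+ n) ->
  exists q, forall e, 0 < e -> exists N, forall n, (N <= n)%N -> d q (u n) < e.
Proof.
move=> compl r01 L0 step; have /andP[r0 r1] := r01.
have tail n k : d (u n) (u (n + k)%N) * (1 - r) <= L * r ^+ n.
  have : d (u n) (u (n + k)%N) * (1 - r) <= L * (r ^+ n - r ^+ (n + k)).
    elim: k => [|k IH]; first by rewrite addn0 mdistxx mul0r subrr mulr0.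
    have t := metric_triangle (u n) (u (n + k)%N) (u (n + k.+1)%N).
    have := step (n + k)%N; rewrite -addnS => st.
    have r1' : 0 <= 1 - r by lra.
    have := ler_wpM2r r1' (le_trans t (lerD (lexx _) st)).
    by rewrite mulrDl addnS exprS; lra.
  move=> /le_trans; apply; rewrite ler_wpM2l// gerBl exprn_ge0//.
have c : cauchy (u @ \oo).
  apply/cauchyP => e e0.
  have r1' : 0 < 1 - r by lra.
  have [N HN] := expr_small r01 L0 (mulr_gt0 e0 r1').
  exists (u N); exists N => // n /= Nn; rewrite ballEmdist /=.
  rewrite -(ltr_pM2r r1') -(subnKC Nn); apply: le_lt_trans (tail _ _) _.
  exact: HN.
have [q uq] := compl _ _ c; exists q => e e0.
have [N _ HN] := uq _ (nbhsx_ballx q e e0).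
by exists N => n Nn; have := HN n Nn; rewrite /= ballEmdist.
Qed.

Lemma sqrt_decay (x W K c : R) n : 0 <= x -> 0 < W -> 0 <= K -> 0 <= c ->
  W * x ^+ 2 <= K * c ^+ n -> x <= Num.sqrt (K / W) * Num.sqrt c ^+ n.
Proof.
move=> x0 W0 K0 c0 le.
rewrite -(ler_pXn2r (_ : 0 < 2)%N) ?nnegrE ?mulr_ge0 ?sqrtr_ge0
  ?exprn_ge0 ?sqrtr_ge0//.
rewrite exprMn sqr_sqrtr ?divr_ge0 ?(ltW W0)// exprAC sqr_sqrtr//.
by rewrite -(ler_pM2l W0) [leRHS]mulrA [W * (K / W)]mulrC divfK ?gt_eqF.
Qed.

End GeometricDecay.

Lemma uniform_lower_bound (R : realType) (V : eqType) (D : seq V)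
    (a : R) (l : V -> \bar R) : (forall x, x \in D -> (a%:E < l x)%E) ->
  exists2 mu : R, a < mu & forall x, x \in D -> (mu%:E <= l x)%E.
Proof.
elim: D => [|x D IH] lD; first by exists (a + 1); rewrite ?ltrDl.
have [|mu amu muD] := IH; first by move=> y yD; apply: lD; rewrite inE yD orbT.
have [nu anu nux] : exists2 nu : R, a < nu & (nu%:E <= l x)%E.
  have := lD x (mem_head _ _); case: (l x) => [b|_|//].
    by rewrite lte_fin => ab; exists b.
  by exists (a + 1); rewrite ?ltrDl// leey.
exists (Num.min mu nu); first by rewrite lt_min amu.
move=> y; rewrite inE => /predU1P[->|yD].
  by apply: le_trans nux; rewrite lee_fin ge_min lexx orbT.
by apply: le_trans (muD y yD); rewrite lee_fin ge_min lexx.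
Qed.

Section InitialMap.
Variables (R : realType) (V : choiceType) (X : complex V) (m : {fset V} -> R).
Variables (G : groupType) (act : G -> V -> V).
Hypothesis act_aut : acts_by_automorphisms X m act.
Hypothesis act_pd : properly_discontinuous X act.
Variable D : seq V.
Hypothesis D_vertices : forall x, x \in D -> vertices X x.
Hypothesis D_orbits : forall x, vertices X x -> exists g, act g x \in D.
Variables (Y : metricType R).
Hypothesis had : hadamard Y.
Variable rho : {multiplicative G -> self_isometry Y}.

Lemma isometryM (g h : G) (y : Y) : rho (g * h)%g y = rho g (rho h y).
Proof. by rewrite gmulfM. Qed.

(** The value at [z] is the barycenter of the finitely many translates of a
    point by the elements that carry a representative to [z]; the group permutes
    these finite families. *)
Lemma exists_equivariant : exists f : V -> Y, equivariant X act rho f.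
Proof.
have [[y0 _] _ cat] := had.
pose s z : seq G := fset_set (visits act D z).
pose w (g : G) : R := 1.
pose v (g : G) := rho g^-1%g y0.
have sP z g : vertices X z -> (g \in s z) = (act g z \in D).
  move=> vz; rewrite in_fset_set; last exact: (finite_visits act_pd D_vertices).
  by apply/idP/idP; rewrite inE.
have w0 z g : g \in s z -> 0 <= w g by [].
have ws z : vertices X z -> 0 < \sum_(g <- s z) w g.
  move=> vz; have [g gz] := D_orbits vz.
  rewrite (big_rem g) ?sP//=; apply: ltr_pwDl => //; exact: sumr_ge0.
have : forall z, exists b, vertices X z ->
    forall q, dispersion (s z) w v b <= dispersion (s z) w v q.
  move=> z; have [vz|vz] := pselect (vertices X z); last by exists y0.
  by have [b bP] := dispersion_min v (@w0 z) had (ws z vz); exists b.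
move=> /choice[f fP]; exists f => g z vz.
have vgz := act_vertex act_aut g vz.
have perm : perm_eq (s (act g z)) [seq (h * g^-1)%g | h <- s z].
  apply: uniq_perm; first exact: fset_uniq.
    by rewrite map_inj_uniq ?fset_uniq// => h h' /mulIg.
  move=> h; rewrite sP//; apply/idP/mapP => [hz|[h' + ->]].
    by exists (h * g)%g; rewrite ?mulgK// sP// (actM act_aut).
  by rewrite sP// (actM act_aut)// (actVK act_aut).
have E q : dispersion (s (act g z)) w v (rho g q) = dispersion (s z) w v q.
  rewrite /dispersion (perm_big _ perm) big_map; apply: eq_bigr => h _.
  by rewrite /v invgM invgK isometryM isometry_dist.
have [q qE] := isometry_surj (rho g) (f (act g z)).
rewrite -qE; congr (rho g _).
apply: (dispersion_min_uniq (v := v) (@w0 z) cat (ws z vz)); last exact: fP.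
by move=> r; rewrite -E qE -E; exact: fP.
Qed.

End InitialMap.

Theorem theorem5p4 (R : realType) (V : choiceType) (X : complex V)
    (m : {fset V} -> R)
    (X_nonempty : vertices X !=set0)
    (X_connected : connected_complex X)
    (X_locally_finite : locally_finite X)
    (X_finite_dimensional : finite_dimensional X)
    (m_admissible : admissible_weight X m)
    (links_connected : forall x, vertices X x -> connected_complex (link X x))
    (links_mu1 : forall x, vertices X x -> ((2^-1 : R)%:E < mu1 X m x)%E)
    (G : groupType) (G_fg : finitely_generated G)
    (act : G -> V -> V)
    (act_aut : acts_by_automorphisms X m act)
    (act_pd : properly_discontinuous X act)
    (act_cofinite : cofinite_action X act)
    (Y : metricType R) (Y_hadamard : hadamard Y)
    (Y_flexible : forall p : Y, flexible (@cone_dist R Y p))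
    (rho : {multiplicative G -> self_isometry Y}) :
  exists q : Y, forall g : G, rho g q = q.
Proof.
have [D [uD Dv Do]] := vertex_representatives act_aut act_cofinite.
have [mu mu_gt mu_le] : exists2 mu : R, 2^-1 < mu &
    forall x, x \in D -> (mu%:E <= mu1 X m x)%E.
  by apply: uniform_lower_bound => x /Dv; exact: links_mu1.
have [f0 ef0] := exists_equivariant act_aut act_pd Dv Do Y_hadamard rho.
have [v0 vv0] := X_nonempty; have [g0 xD] := Do _ vv0.
set x0 := act g0 v0 in xD; have vx0 := Dv _ xD.
have [n0|/eqP] := eqVneq (neighbors X x0) [::].
  (* an isolated vertex is the only one, hence fixed by the group *)
  exists (f0 x0) => g; rewrite -ef0//.
  have [p] := X_connected _ _ vx0 (act_vertex act_aut g vx0).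
  case: p => [_ /= <- //|y p /= /andP[/asboolP e _] _].
  by move/(neighborsP X_locally_finite): e; rewrite n0.
case E : (neighbors X x0) => [//|y0 s] _.
have y0x : y0 \in neighbors X x0 by rewrite E mem_head.
pose energy (f : V -> Y) := energy X m act D f f.
pose W x y := orbit_weight R act D x * edge_weight m x y.
have W0 x y : x \in D -> y \in neighbors X x -> 0 < W x y.
  move=> xD' yx; rewrite mulr_gt0 ?(orbit_weight_gt0 R act_pd)//.
  exact: (edge_weight_gt0 X_locally_finite m_admissible).
pose c := rate mu; have /andP[c0 c1] : 0 < c < 1 by exact: rate_itv.
have : forall f, exists f1, equivariant X act rho f ->
    [/\ equivariant X act rho f1, energy f1 <= c * energy f &
    forall x y, x \in D -> y \in neighbors X x ->
      W x y * mdist (f x) (f1 x) ^+ 2 <= 4 * energy f].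
  move=> f; have [ef|ef] := pselect (equivariant X act rho f); last by exists f.
  have [f1 [ef1 le1 dist1]] := flow_step X_locally_finite m_admissible
    links_connected act_aut act_pd uD Dv Do mu_gt mu_le Y_hadamard Y_flexible ef.
  by exists f1 => _; split=> // x y xD' yx; rewrite -mulrA; exact: dist1.
move=> /choice[S SP]; pose F n := iter n S f0.
have eF n : equivariant X act rho (F n).
  by elim: n => //= n IH; have [] := SP _ IH.
set A := energy f0.
have A0 : 0 <= A by exact: (energy_ge0 X_locally_finite m_admissible act_pd Dv Do).
have decay n : energy (F n) <= A * c ^+ n.
  elim: n => [|n IH]; first by rewrite expr0 mulr1.
  have [_ le _] := SP _ (eF n); apply: (le_trans le).
  by rewrite exprS mulrCA ler_wpM2l// ltW.
pose r := Num.sqrt c.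
have r01 : 0 <= r < 1.
  by rewrite sqrtr_ge0 /= -sqrtr1 ltr_sqrt.
have decay_step : exists2 L : R, 0 <= L &
    forall n, mdist (F n x0) (F n.+1 x0) <= L * r ^+ n.
  exists (Num.sqrt (4 * A / W x0 y0)); first exact: sqrtr_ge0.
  move=> n; apply: sqrt_decay; rewrite ?mdist_ge0 ?W0 ?mulr_ge0 ?(ltW c0)//.
  have [_ _ dist1] := SP _ (eF n); apply: le_trans (dist1 _ _ xD y0x) _.
  by rewrite -mulrA ler_pM2l.
have decay_edge x y : ordered_edge X x y -> exists2 L : R, 0 <= L &
    forall n, mdist (F n x) (F n y) <= L * r ^+ n.
  move=> xy; have [vx vy] := ordered_edge_vertices xy; have [g gxD] := Do _ vx.
  have gyx : act g y \in neighbors X (act g x).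
    by apply/(neighborsP X_locally_finite); exact: (act_edge act_aut).
  exists (Num.sqrt (A / W (act g x) (act g y))); first exact: sqrtr_ge0.
  move=> n; rewrite -(equivariant_dist g (eF n) (eF n) vx vy).
  apply: sqrt_decay; rewrite ?mdist_ge0 ?W0 ?(ltW c0)//.
  apply: le_trans (decay n); rewrite -mulrA.
  apply: (@orbit_sum_term _ _ X _ act D _ (fun x y =>
    edge_weight m x y * mdist (F n x) (F n y) ^+ 2)) => //.
    exact: (orbit_weight_ge0 R act_pd Dv Do).
  move=> x' y' _ yx'; rewrite mulr_ge0 ?sqr_ge0// ltW//.
  exact: (edge_weight_gt0 X_locally_finite m_admissible).
have decay_path p x : path (fun u v => `[< ordered_edge X u v >]) x p ->
    exists2 L : R, 0 <= L & forall n, mdist (F n x) (F n (last x p)) <= L * r ^+ n.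
  elim: p x => [|y p IH] x /=; first by exists 0 => // n; rewrite mdistxx mul0r.
  move=> /andP[/asboolP/decay_edge[L1 L10 H1] /IH[L2 L20 H2]].
  exists (L1 + L2); first exact: addr_ge0.
  move=> n; rewrite mulrDl; apply: le_trans (metric_triangle _ (F n y) _) _.
  exact: lerD.
have [L L0 HL] := decay_step; have [_ compl _] := Y_hadamard.
have [q qP] := geometric_limit compl r01 L0 HL.
exists q => g; apply/mdist_positivity/eqP; rewrite eq_le mdist_ge0 andbT.
apply/ler_addgt0Pr => e e0; rewrite add0r.
have e30 : 0 < e / 3 by rewrite divr_gt0.
(* by equivariance [rho g] maps [F n x0] to [F n (act g x0)] *)
have [p pp lp] := X_connected _ _ vx0 (act_vertex act_aut g vx0).
have [L' L'0 HL'] := decay_path _ _ pp; rewrite lp in HL'.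
have [N1 H1] := qP _ e30; have [N2 H2] := expr_small r01 L'0 e30.
pose n := maxn N1 N2.
have h1 := H1 n (leq_maxl _ _); have h2 := H2 n (leq_maxr _ _).
have h3 := HL' n; rewrite eF// in h3.
have t1 := metric_triangle (rho g q) (rho g (F n x0)) q.
have t2 := metric_triangle (rho g (F n x0)) (F n x0) q.
rewrite isometry_dist in t1.
rewrite [mdist (F n x0) q]metric_sym [mdist (rho g _) (F n x0)]metric_sym in t2.
by lra.
Qed.
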